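(* Consider the problem $\min_{x\in\mathcal X}\varphi(x)$ with $\varphi(x)=F(f(x),x)$ and the Hessian-corrected version of the Hybrid Momentum Stochastic Frank--Wolfe algorithm with Taylor function tracker, as described in the context. Suppose: (1) $\mathcal X\subset\mathbb R^d$ is convex and compact with diameter $D_{\mathcal X}<\infty$; (2) $F:\mathbb R^n\times\mathcal X\to\mathbb R$ is $L_F$-Lipschitz in its first argument $u$; is monotone non-decreasing in $u$ ($u_1\le u_2$ componentwise implies $F(u_1,x)\le F(u_2,x)$); and is subhomogeneous in $u$ ($F(\gamma u,x)\le\gamma F(u,x)$ for all $\gamma\ge1$); (3) $f:\mathcal X\to\mathbb R^n$ is $C^2$ with $L$-Lipschitz Jacobian, $\|\nabla f(x)-\nabla f(y)\|_{\mathrm{op}}\le L\|x-y\|$ for all $x,y\in\mathcal X$, and $\|\nabla^2f(x)\|_{\mathrm{op}}\le L$ on $\mathcal X$; (4) there are $r\in(1,2]$ and $\sigma_f,\sigma_g\ge0$ such that for every $x\in\mathcal X$ the oracle outputs $\tilde f(x;\xi)$, $\nabla\tilde f(x;\xi)$ are unbiased estimates of $f(x)$, $\nabla f(x)$ with $\mathbb E_\xi\|\tilde f(x;\xi)-f(x)\|^r\le\sigma_f^r$ and $\mathbb E_\xi\|\nabla\tilde f(x;\xi)-\nabla f(x)\|^r\le\sigma_g^r$; (5) there is $\sigma_H\ge0$ such that $\tilde f(\cdot;\xi)$ is twice differentiable on $\mathcal X$ almost surely, with $\mathbb E_\xi[\nabla^2\tilde f(x;\xi)]=\nabla^2f(x)$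 and $\mathbb E_\xi\|\nabla^2\tilde f(x;\xi)-\nabla^2f(x)\|_{\mathrm{op}}^r\le\sigma_H^r$ for all $x\in\mathcal X$ (same $r$). With the constant schedule $\gamma=\beta=\rho=K^{-r/(2r-1)}$, $$\min_{1\le k\le K}\mathbb E[\hat\Delta_k]=\mathcal O\big(K^{-(r-1)/(2r-1)}\big),$$ where the $\mathcal O(\cdot)$ is as $K\to\infty$ with a constant independent of $K$.
   Context: Norms: $\|\cdot\|$ is the Euclidean norm on vectors and the Frobenius norm on matrices; $\|\cdot\|_{\mathrm{op}}$ is the operator norm; a second derivative $\nabla^2f(x)$ is viewed as a linear map $h\mapsto\nabla^2f(x)[h]$ from $\mathbb R^d$ to $\mathbb R^{n\times d}$ (the derivative of the Jacobian), with $\|T\|_{\mathrm{op}}=\sup_{\|h\|=1}\|T[h]\|$. $D_{\mathcal X}=\max_{x,y\in\mathcal X}\|x-y\|$. Problem: $f(x)=\mathbb E_\xi[\tilde f(x;\xi)]$ has Jacobian $\nabla f(x)\in\mathbb R^{n\times d}$, and $\varphi(x)=F(f(x),x)$. All minima over $\mathcal X$ appearing are assumed attained. The generalized Frank--Wolfe gap at $y\in\mathcal X$ is $\hat\Delta(y)=\varphi(y)-\min_{x\in\mathcal X}F(f(y)+\nabla f(y)(x-y),x)$, and $\hat\Delta_k:=\hat\Delta(y_k)$. Algorithm (Hessian-corrected version), with constant parameters $\gamma,\beta,\rho\in(0,1]$ and deterministic $y_0\in\mathcal X$. Random variables: $\xi_0,\xi_1,\dots$ and $\zeta_1,\zeta_2,\dots$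 are draws from the oracle distribution and $\alpha_1,\alpha_2,\dots$ are uniform on $(0,1)$, all mutually independent. Initialize $z_0=\tilde f(y_0;\xi_0)\in\mathbb R^n$, $V_0=\nabla\tilde f(y_0;\xi_0)\in\mathbb R^{n\times d}$. For every $k\ge1$, at the current point $y_k$: set $y_{\alpha,k}=y_{k-1}+\alpha_k(y_k-y_{k-1})$ and $\tilde H_k=\nabla^2\tilde f(y_{\alpha,k};\zeta_k)$; - Jacobian tracker: $V_k=(1-\beta)V_{k-1}+\beta\nabla\tilde f(y_k;\xi_k)+(1-\beta)\tilde H_k(y_k-y_{k-1})$, where $\tilde H_k(h)$ means $\tilde H_k[h]\in\mathbb R^{n\times d}$; - Taylor function tracker (Variant II): $z_k=(1-\rho)[z_{k-1}+V_k(y_k-y_{k-1})]+\rho\tilde f(y_k;\xi_k)$. For every $k\ge0$: $x_{k+1}\in\arg\min_{x\in\mathcal X}F(z_k+V_k(x-y_k),x)$ and $y_{k+1}=(1-\gamma)y_k+\gamma x_{k+1}$.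
   Formalization: F is additionally assumed jointly convex in (u,x); without this the claim fails (e.g. f=0, X=[0,1], F=0 at x=0 and 1 elsewhere, y_0=1 gives gap 1 for all k). Oracle outputs are taken jointly measurable and x_{k+1} measurable in the draws so far. *)

(* Defs.v *)
(* MathComp / MathComp-Analysis development. *)
From HB Require Import structures.
From mathcomp Require Export all_boot all_order all_algebra finmap.
From mathcomp Require Export all_classical all_reals all_analysis.

Set Implicit Arguments.
Unset Strict Implicit.
Unset Printing Implicit Defensive.

Export Order.TTheory GRing.Theory Num.Theory.
Export numFieldNormedType.Exports.

#[global] Open Scope classical_set_scope.
#[global] Open Scope ring_scope.

(* Frobenius norm; on column vectors ([p = 1]) it is the Euclidean norm.  The
   library norm [`|A|] on matrices is the sup norm; it induces the same
   topology, so [nbhs], [open] and [compact] below are the usual notions. *)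
Definition fnorm (R : realType) (m p : nat) (A : 'M[R]_(m, p)) : R :=
  Num.sqrt (\sum_(i < m) \sum_(j < p) A i j ^+ 2).

(* Meaningful for linear [T] (the set is then bounded, so [sup] is not its
   default value); for [d = 0] the sphere is empty and the value is 0. *)
Definition opnorm (R : realType) (d m p : nat)
    (T : 'cV[R]_d -> 'M[R]_(m, p)) : R :=
  sup [set fnorm (T h) | h in [set h | fnorm h = 1]].

(* Frechet derivative relative to [X]: [f] is only given on [X], so the
   increments stay in [X]; at interior points this is the usual derivative. *)
Definition has_derivative_on (R : realType) (d m p : nat) (X : set 'cV[R]_d)
    (f : 'cV[R]_d -> 'M[R]_(m, p)) (Df : 'cV[R]_d -> 'cV[R]_d -> 'M[R]_(m, p))
    : Prop :=
  forall x, X x -> forall e : R, 0 < e ->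
    \forall y \near within X (nbhs x),
      fnorm (f y - f x - Df x (y - x)) <= e * fnorm (y - x).

(* [J x] is the Jacobian matrix and [H x] the derivative of [J] at [x]. *)
Definition twice_differentiable_on (R : realType) (d n : nat)
    (X : set 'cV[R]_d) (f : 'cV[R]_d -> 'cV[R]_n) (J : 'cV[R]_d -> 'M[R]_(n, d))
    (H : 'cV[R]_d -> {linear 'cV[R]_d -> 'M[R]_(n, d)}) : Prop :=
  has_derivative_on X f (fun x h => J x *m h) /\
  has_derivative_on X J (fun x h => H x h).

Definition C2_on (R : realType) (d n : nat)
    (X : set 'cV[R]_d) (f : 'cV[R]_d -> 'cV[R]_n) (J : 'cV[R]_d -> 'M[R]_(n, d))
    (H : 'cV[R]_d -> {linear 'cV[R]_d -> 'M[R]_(n, d)}) : Prop :=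
  twice_differentiable_on X f J H /\
  (forall x, X x -> forall e : R, 0 < e ->
     \forall y \near within X (nbhs x), opnorm (fun h => H y h - H x h) <= e).

Definition is_argmin (R : realType) (T : Type) (X : set T) (g : T -> R) (x : T)
    : Prop :=
  X x /\ forall x', X x' -> g x <= g x'.

Definition fw_gap (R : realType) (d n : nat) (X : set 'cV[R]_d)
    (F : 'cV[R]_n -> 'cV[R]_d -> R) (f : 'cV[R]_d -> 'cV[R]_n)
    (J : 'cV[R]_d -> 'M[R]_(n, d)) (y : 'cV[R]_d) : R :=
  F (f y) y - inf [set F (f y + J y *m (x - y)) x | x in X].

(* R^d with its Borel sigma-algebra. *)
Definition borel_cV (R : realType) (d : nat) :=
  g_sigma_algebraType (@open 'cV[R]_d).

(* Joint measurability in (x, xi), for x in [X], of each entry. *)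
Definition jointly_measurable (R : realType) (d m p : nat)
    (dXi : measure_display) (Xi : measurableType dXi) (X : set 'cV[R]_d)
    (g : 'cV[R]_d -> Xi -> 'M[R]_(m, p)) : Prop :=
  forall i j, measurable_fun ((X : set (borel_cV R d)) `*` [set: Xi])
    (fun q : borel_cV R d * Xi => g q.1 q.2 i j).

Definition is_mean (R : realType) (dXi : measure_display)
    (Xi : measurableType dXi) (D : probability Xi R) (m p : nat)
    (g : Xi -> 'M[R]_(m, p)) (A : 'M[R]_(m, p)) : Prop :=
  forall i j, D.-integrable [set: Xi] (EFin \o (fun s => g s i j)) /\
    ('E_D[fun s => g s i j] = (A i j)%:E)%E.

Definition mutually_independent (R : realType) (dO : measure_display)
    (Omega : measurableType dO) (P : probability Omega R)
    (I : choiceType) (E : I -> set (set Omega)) : Prop :=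
  forall (S : {fset I}) (A : I -> set Omega),
    (forall i, i \in S -> E i (A i)) ->
    (P (\bigcap_(i in [set` S]) A i) = \prod_(i <- enum_fset S) P (A i))%E.

(* The random draws, listed as xi_k for k >= 0 ([inl (inl k)]), and zeta_k,
   alpha_k for k >= 1 ([inl (inr k)] and [inr k] stand for zeta_(k+1) and
   alpha_(k+1)); [zeta 0] and [alpha 0] are never used. *)
Definition draw_events (R : realType) (dO dXi : measure_display)
    (Omega : measurableType dO) (Xi : measurableType dXi)
    (xi zeta : nat -> Omega -> Xi) (alpha : nat -> Omega -> R)
    (s : nat + nat + nat) : set (set Omega) :=
  match s with
  | inl (inl k) => preimage_set_system [set: Omega] (xi k) measurable
  | inl (inr k) => preimage_set_system [set: Omega] (zeta k.+1) measurable
  | inr k => preimage_set_system [set: Omega] (alpha k.+1) measurable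
  end.

Definition draw_time (s : nat + nat + nat) : nat :=
  match s with inl (inl k) => k | inl (inr k) => k.+1 | inr k => k.+1 end.

(* sigma-algebra generated by all draws made up to iteration [k]. *)
Definition history (R : realType) (dO dXi : measure_display)
    (Omega : measurableType dO) (Xi : measurableType dXi)
    (xi zeta : nat -> Omega -> Xi) (alpha : nat -> Omega -> R) (k : nat)
    : set (set Omega) :=
  <<s \bigcup_(s in [set s | (draw_time s <= k)%N])
        draw_events xi zeta alpha s >>.

Definition sampling (R : realType) (dO dXi : measure_display)
    (Omega : measurableType dO) (Xi : measurableType dXi)
    (P : probability Omega R) (D : probability Xi R)
    (xi zeta : nat -> {RV P >-> Xi}) (alpha : nat -> {RV P >-> R}) : Prop :=
  [/\ forall k A, measurable A -> distribution P (xi k) A = D A,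
      forall k A, measurable A -> distribution P (zeta k.+1) A = D A,
      forall k A, measurable A ->
        distribution P (alpha k.+1) A = uniform_prob (@ltr01 R) A,
      forall k w, 0 < alpha k.+1 w < 1
    & mutually_independent P (draw_events xi zeta alpha)].

(* A run of the Hessian-corrected method with Taylor function tracker.  The
   linear minimization step may break ties in any way that depends measurably
   on the draws made so far: x_(k+1) is measurable for [history k]. *)
Definition hessian_sfw_run (R : realType) (d n : nat)
    (dO dXi : measure_display)
    (Omega : measurableType dO) (Xi : measurableType dXi)
    (X : set 'cV[R]_d) (F : 'cV[R]_n -> 'cV[R]_d -> R)
    (ft : 'cV[R]_d -> Xi -> 'cV[R]_n) (Jt : 'cV[R]_d -> Xi -> 'M[R]_(n, d))
    (Ht : 'cV[R]_d -> Xi -> {linear 'cV[R]_d -> 'M[R]_(n, d)})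
    (y0 : 'cV[R]_d) (gamma beta rho : R)
    (xi zeta : nat -> Omega -> Xi) (alpha : nat -> Omega -> R)
    (x y : nat -> Omega -> 'cV[R]_d) (z : nat -> Omega -> 'cV[R]_n)
    (V : nat -> Omega -> 'M[R]_(n, d)) : Prop :=
  [/\ forall w, [/\ y 0%N w = y0,
                    z 0%N w = ft y0 (xi 0%N w)
                  & V 0%N w = Jt y0 (xi 0%N w)],
      forall k w,
        let h := y k.+1 w - y k w in
        let y_alpha := y k w + alpha k.+1 w *: h in
        V k.+1 w = (1 - beta) *: V k w
                   + beta *: Jt (y k.+1 w) (xi k.+1 w)
                   + (1 - beta) *: Ht y_alpha (zeta k.+1 w) h
        /\ z k.+1 w = (1 - rho) *: (z k w + V k.+1 w *m h)
                      + rho *: ft (y k.+1 w) (xi k.+1 w),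
      forall k w,
        is_argmin X (fun x' => F (z k w + V k w *m (x' - y k w)) x')
          (x k.+1 w)
        /\ y k.+1 w = (1 - gamma) *: y k w + gamma *: x k.+1 w
    & forall k (i : 'I_d) (B : set R), measurable B ->
        history xi zeta alpha k ((fun w => x k.+1 w i 0) @^-1` B)].

(* Main.v *)
(* Convexity of [F] and a Taylor expansion of [f] bound [gamma * gap (y k)] by
   the decrease of [phi] plus [gamma] times the errors of the two trackers plus
   [O(gamma^2)]; telescoping leaves the sums of [|V k - J (y k)|] and
   [|z k - f (y k)|].  The Jacobian error obeys
     e_(k+1) = (1 - step) e_k + martingale increment:
   revealing alpha, then zeta, then xi, each contributes a centered term of size
   [O(step)], the alpha term being centered because the integral of the Hessian
   along a segment is the increment of the Jacobian.  An elementary three-term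
   expansion of [|a + b|^r] turns this into
     E |e_(k+1)|^r <= (1 - step) E |e_k|^r + C step^r,
   hence E |e_k| = O((1 - step)^(k/r) + step^((r-1)/r)).  The error of [z] splits
   into a process of the same kind and a remainder bounded pathwise by the
   Jacobian errors. *)
Require Import Defs.
From HB Require Import structures.
From mathcomp Require Import measurable_realfun ring lra.

Set Implicit Arguments.
Unset Strict Implicit.
Unset Printing Implicit Defensive.

(** * Frobenius inner product and powers of the norm *)

(** The Hessian correction is there to remove the drift. Without it the moving target would add
    [J (y k) - J (y k.+1)] to the Jacobian error, a non-centered term of order [step], and a
    contraction of rate [step] turns this into an error of order 1. The correction subtracts an
    unbiased estimate of the drift, so that only centered terms of size [step] remain.

    The averaged gap is then of order 1/(K step) + step^((r-1)/r) + step, and the schedule equates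
    the first two terms.

    Conditional expectations are replaced by product laws: the past is the sample space itself with
    a smaller sigma-algebra, it is independent of the next draw, and Tonelli integrates that draw
    out with the past frozen.

    The error of [z] is not treated by one such recursion, because it is driven by [V k.+1], whose
    error is not centered given the past. Only the noise of [ft] goes through moments; the influence
    of [V] comes multiplied by a displacement of size [step], which the contraction absorbs path by
    path. *)

Section Frobenius.
Context {R : realType} {m p : nat}.
Implicit Types (A B C : 'M[R]_(m, p)) (c : R).

Definition fdot A B : R := \sum_(i < m) \sum_(j < p) A i j * B i j.

Lemma fdotC A B : fdot A B = fdot B A.
Proof. by apply: eq_bigr => i _; apply: eq_bigr => j _; rewrite mulrC. Qed.

Lemma fdotDl A B C : fdot (A + B) C = fdot A C + fdot B C.
Proof.
rewrite /fdot -big_split; apply: eq_bigr => i _.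
by rewrite -big_split; apply: eq_bigr => j _; rewrite mxE mulrDl.
Qed.

Lemma fdotZl c A B : fdot (c *: A) B = c * fdot A B.
Proof.
rewrite /fdot mulr_sumr; apply: eq_bigr => i _.
by rewrite mulr_sumr; apply: eq_bigr => j _; rewrite mxE mulrA.
Qed.

Lemma fdotDr A B C : fdot A (B + C) = fdot A B + fdot A C.
Proof. by rewrite fdotC fdotDl !(fdotC A). Qed.

Lemma fdotZr c A B : fdot A (c *: B) = c * fdot A B.
Proof. by rewrite fdotC fdotZl fdotC. Qed.

Lemma fdot0l A : fdot 0 A = 0.
Proof. by rewrite -(scale0r A) fdotZl mul0r. Qed.

Lemma fdot0r A : fdot A 0 = 0.
Proof. by rewrite fdotC fdot0l. Qed.

Lemma fdotNr A B : fdot A (- B) = - fdot A B.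
Proof. by rewrite -scaleN1r fdotZr mulN1r. Qed.

Lemma fdotBr A B C : fdot A (B - C) = fdot A B - fdot A C.
Proof. by rewrite fdotDr fdotNr. Qed.

Lemma fdot_ge0 A : 0 <= fdot A A.
Proof. by apply: sumr_ge0 => i _; apply: sumr_ge0 => j _; rewrite -expr2 sqr_ge0. Qed.

Lemma fnorm_ge0 A : 0 <= fnorm A.
Proof. exact: sqrtr_ge0. Qed.

Lemma sqr_fnorm A : fnorm A ^+ 2 = fdot A A.
Proof.
by rewrite /fnorm (_ : \sum_i _ = fdot A A) ?sqr_sqrtr ?fdot_ge0.
Qed.

Lemma ler_fnorm_entry A i j : `|A i j| <= fnorm A.
Proof.
rewrite -(ler_pXn2r (n := 2)) ?nnegrE ?fnorm_ge0// sqr_fnorm /fdot.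
rewrite (bigD1 i)//= (bigD1 j)//= real_normK ?num_real// -addrA expr2 lerDl.
apply: addr_ge0; first by apply: sumr_ge0 => k _; rewrite -expr2 sqr_ge0.
by apply: sumr_ge0 => k _; apply: sumr_ge0 => l _; rewrite -expr2 sqr_ge0.
Qed.

Lemma fnorm_eq0 A : fnorm A = 0 -> A = 0.
Proof.
move=> A0; apply/matrixP => i j; rewrite mxE; apply/eqP.
by rewrite -normr_le0 -A0 ler_fnorm_entry.
Qed.

Lemma fnorm0 : fnorm (0 : 'M[R]_(m, p)) = 0.
Proof. by apply/eqP; rewrite -(sqrf_eq0 (fnorm _)) sqr_fnorm fdot0l. Qed.

Lemma fnormZ c A : fnorm (c *: A) = `|c| * fnorm A.
Proof.
apply/eqP; rewrite -(eqrXn2 (n := 2))// ?mulr_ge0 ?fnorm_ge0//.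
by rewrite sqr_fnorm exprMn sqr_fnorm fdotZl fdotZr real_normK ?num_real// expr2 mulrA.
Qed.

Lemma fnormN A : fnorm (- A) = fnorm A.
Proof. by rewrite -scaleN1r fnormZ normrN1 mul1r. Qed.

Lemma sqr_fnormD A B :
  fnorm (A + B) ^+ 2 = fnorm A ^+ 2 + fdot A B *+ 2 + fnorm B ^+ 2.
Proof. by rewrite !sqr_fnorm fdotDl !fdotDr (fdotC B A); ring. Qed.

(** Cauchy-Schwarz, from the nonnegativity of the squared norm of |B| A - |A| B. *)
Lemma ler_fdot A B : fdot A B <= fnorm A * fnorm B.
Proof.
have [/fnorm_eq0 ->|A0] := eqVneq (fnorm A) 0.
  by rewrite fnorm0 mul0r fdot0l.
have [/fnorm_eq0 ->|B0] := eqVneq (fnorm B) 0.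
  by rewrite fnorm0 mulr0 fdot0r.
have Agt0 : 0 < fnorm A by rewrite lt_neqAle eq_sym A0 fnorm_ge0.
have Bgt0 : 0 < fnorm B by rewrite lt_neqAle eq_sym B0 fnorm_ge0.
have := sqr_ge0 (fnorm (fnorm B *: A + (- fnorm A) *: B)).
rewrite sqr_fnormD !fnormZ normrN !ger0_norm ?fnorm_ge0// fdotZl fdotZr.
move=> h; rewrite -(ler_pM2l (mulr_gt0 Agt0 Bgt0)); nra.
Qed.

Lemma ler_norm_fdot A B : `|fdot A B| <= fnorm A * fnorm B.
Proof. by rewrite ler_norml ler_fdot andbT lerNl -fdotNr -(fnormN B) ler_fdot. Qed.

Lemma ler_fnormD A B : fnorm (A + B) <= fnorm A + fnorm B.
Proof.
rewrite -(ler_pXn2r (n := 2)) ?nnegrE ?addr_ge0 ?fnorm_ge0//.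
rewrite sqr_fnormD; have := ler_fdot A B; nra.
Qed.

Lemma ler_fnormB A B : fnorm (A - B) <= fnorm A + fnorm B.
Proof. by rewrite -(fnormN B) ler_fnormD. Qed.

Lemma ler_fnorm_sum (I : Type) (s : seq I) (P : pred I) (E : I -> 'M[R]_(m, p)) :
  fnorm (\sum_(i <- s | P i) E i) <= \sum_(i <- s | P i) fnorm (E i).
Proof.
elim/big_rec2: _ => [|i y x _ xy]; first by rewrite fnorm0.
by rewrite (le_trans (ler_fnormD _ _))// lerD2l.
Qed.

Lemma ler_fnorm_sum_entry A : fnorm A <= \sum_i \sum_j `|A i j|.
Proof.
have e1 (i : 'I_m) (j : 'I_p) : fnorm (delta_mx i j : 'M[R]_(m, p)) <= 1.
  rewrite -(ler_pXn2r (n := 2)) ?nnegrE ?fnorm_ge0// sqr_fnorm /fdot.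
  rewrite (bigD1 i)//= (bigD1 j)//= !mxE !eqxx mulr1 !big1 ?addr0 ?expr1n//.
  - by move=> k /negbTE ki; rewrite big1// => l _; rewrite mxE ki mul0r.
  - by move=> k /negbTE ki; rewrite mxE ki andbF mul0r.
rewrite [X in fnorm X]matrix_sum_delta (le_trans (ler_fnorm_sum _ _ _))//.
apply: ler_sum => i _; rewrite (le_trans (ler_fnorm_sum _ _ _))//.
apply: ler_sum => j _; rewrite fnormZ -[leRHS]mulr1 ler_wpM2l//.
Qed.

(** Neighbourhoods and compactness are those of the sup norm, estimates are in the Frobenius norm;
    this bound passes from one to the other. *)
Lemma ler_fnorm_mx_norm A : fnorm A <= (m * p)%:R * `|A|.
Proof.
rewrite (le_trans (ler_fnorm_sum_entry A))//.
have h i j : `|A i j| <= `|A|.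
  by rewrite [leRHS]/Num.norm/= mx_normrE; apply/bigmax_geP; right; exists (i, j).
rewrite (le_trans (ler_sum _ (fun i _ => ler_sum _ (fun j _ => h i j))))//.
by rewrite !sumr_const !card_ord -mulrnA mulnC mulr_natl.
Qed.

End Frobenius.

Lemma ler_powR_tangent (R : realType) (s p : R) : 0 <= s -> 0 < p <= 1 ->
  s `^ p <= 1 + p * (s - 1).
Proof.
move=> s0 /andP[p0]; rewrite le_eqVlt => /predU1P[->|p1].
  by rewrite powRr1// mul1r addrC subrK.
have q0 : 0 < 1 - p by rewrite subr_gt0.
have := @conjugate_powR R (s `^ p) 1 p^-1 (1 - p)^-1.
rewrite powR_ge0 ler01 invr_gt0 p0 invr_gt0 q0 !invrK -powRrM mulfV ?gt_eqF//.
rewrite powRr1// powR1 mulr1 mul1r => /(_ erefl erefl erefl erefl).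
by rewrite addrC subrK => /(_ erefl) h; rewrite (le_trans h)//; lra.
Qed.

(** The tangent line at [a] of the concave power, obtained from the tangent at 1 by factoring out
    [a]. *)
Lemma ler_powRD (R : realType) (a x p : R) : 0 < a -> 0 <= a + x -> 0 < p <= 1 ->
  (a + x) `^ p <= a `^ p + p * a `^ (p - 1) * x.
Proof.
move=> a0 ax p01.
have -> : a + x = a * ((a + x) / a) by rewrite mulrC divfK ?gt_eqF.
have s0 : 0 <= (a + x) / a by rewrite divr_ge0// ltW.
rewrite powRM ?(ltW a0)// powRB ?(gt_eqF a0) ?implybT// powRr1 ?(ltW a0)//.
have h := ler_wpM2l (powR_ge0 a p) (ler_powR_tangent s0 p01).
rewrite (le_trans h)//.
rewrite le_eqVlt; apply/orP; left; apply/eqP; field.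
by rewrite gt_eqF.
Qed.

(* The three-term expansion behind the von Bahr-Esseen inequality: the middle
   term is linear in [B], so it averages out when [B] is centered. *)
Lemma powR_fnormD (R : realType) m p (r : R) (A B : 'M[R]_(m, p)) : 1 < r <= 2 ->
  fnorm (A + B) `^ r <=
  fnorm A `^ r + r * fnorm A `^ (r - 2) * fdot A B + 6 * fnorm B `^ r.
Proof.
move=> /andP[r1 r2]; have r0 : 0 < r by lra.
have half (C : 'M[R]_(m, p)) q : (fnorm C ^+ 2) `^ (q / 2) = fnorm C `^ q.
  by rewrite -powR_mulrn ?fnorm_ge0// -powRrM mulrC divfK.
have [A0|A0] := eqVneq (fnorm A) 0.
  rewrite A0 (fnorm_eq0 A0) add0r fdot0l mulr0 addr0.
  by rewrite powR0 ?gt_eqF// add0r ler_peMl ?powR_ge0//; lra.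
have Agt0 : 0 < fnorm A by rewrite lt_neqAle eq_sym A0 fnorm_ge0.
(* If |B| <= |A|, the concave power r/2 of |A + B|^2 lies below its tangent at |A|^2; the quadratic
   remainder |A|^(r-2) |B|^2 is at most |B|^r because r - 2 <= 0. *)
have [BA|AB] := leP (fnorm B) (fnorm A).
  have [/fnorm_eq0->|B0] := eqVneq (fnorm B) 0.
    rewrite fnorm0 powR0 ?gt_eqF// addr0 fdot0r !mulr0.
    by rewrite !addr0.
  have Bgt0 : 0 < fnorm B by rewrite lt_neqAle eq_sym B0 fnorm_ge0.
  have := sqr_fnormD A B; rewrite -addrA => e.
  have := @ler_powRD R (fnorm A ^+ 2) (fdot A B *+ 2 + fnorm B ^+ 2) (r / 2).
  rewrite -e !half exprn_gt0// sqr_ge0.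
  have -> : r / 2 - 1 = (r - 2) / 2 by lra.
  rewrite half => /(_ erefl erefl) h.
  have {h} := h ltac:(lra); move/le_trans; apply.
  have q : fnorm A `^ (r - 2) * fnorm B ^+ 2 <= fnorm B `^ r.
    have -> : fnorm B `^ r = fnorm B `^ (r - 2) * fnorm B ^+ 2.
      rewrite -powR_mulrn ?fnorm_ge0// -powRD ?subrK//.
      by rewrite (negbTE (lt0r_neq0 Bgt0)) implybT.
    rewrite ler_wpM2r ?sqr_ge0// -(opprB 2 r) !powRN lef_pV2 ?posrE ?powR_gt0//.
    by rewrite ge0_ler_powR ?nnegrE ?fnorm_ge0// subr_ge0.
  have b0 := powR_ge0 (fnorm B) r; move: (fnorm A `^ (r - 2)) q => a q.
  have : r * (a * fnorm B ^+ 2) <= 2 * fnorm B `^ r.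
    rewrite (le_trans (ler_wpM2l (ltW r0) q))// ler_wpM2r//.
  lra.
have Bgt0 : 0 < fnorm B by apply: lt_trans AB.
have ABr : fnorm A `^ (r - 2) * fnorm A * fnorm B <= fnorm B `^ r.
  rewrite -{2}(powRr1 (fnorm_ge0 A)) -powRD ?(gt_eqF Agt0) ?implybT//.
  rewrite -(mulr_powRB1 (fnorm_ge0 B) r0) mulrC ler_wpM2l ?fnorm_ge0//.
  have -> : r - 2 + 1 = r - 1 by lra.
  by rewrite ge0_ler_powR ?nnegrE ?fnorm_ge0 ?ltW//; lra.
(* If |A| < |B|, crude bounds suffice: 2^r <= 4 for the left side and r <= 2 for the linear term.
   Their sum is the constant 6. *)
have AB2 : fnorm (A + B) `^ r <= 4 * fnorm B `^ r.
  have : fnorm (A + B) <= 2 * fnorm B.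
    by rewrite (le_trans (ler_fnormD _ _))//; lra.
  move/(@ge0_ler_powR _ r (ltW r0) _ _); rewrite !nnegrE fnorm_ge0.
  rewrite mulr_ge0 ?fnorm_ge0// powRM ?fnorm_ge0// => /(_ erefl erefl).
  move/le_trans; apply; rewrite ler_wpM2r ?powR_ge0//.
  have -> : (4 : R) = 2 `^ 2%:R by rewrite powR_mulrn// -natrX.
  by rewrite ler_powR// ler1n.
have := ler_norm_fdot A B; rewrite ler_norml => /andP[lo _].
have := powR_ge0 (fnorm A) r; have a0 := powR_ge0 (fnorm A) (r - 2).
move: (fnorm A `^ (r - 2)) a0 ABr => a a0 ABr.
have h1 : - (a * fnorm A * fnorm B) <= a * fdot A B.
  by rewrite -mulrA -mulrN ler_wpM2l.
have b0 := powR_ge0 (fnorm B) r => Ar0.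
have : r * (- fnorm B `^ r) <= r * (a * fdot A B).
  by rewrite ler_wpM2l ?(ltW r0)// (le_trans _ h1)// lerN2.
rewrite mulrA => h2; have : r * fnorm B `^ r <= 2 * fnorm B `^ r by rewrite ler_wpM2r.
lra.
Qed.

(* Stands in for Jensen: integrated with [s] the r-th root of a bound on the r-th
   moment, it bounds the first moment by [2 s]. *)
Lemma ler_addM_powR (R : realType) (r s t : R) : 1 <= r -> 0 < s -> 0 <= t ->
  t <= s + s `^ (1 - r) * t `^ r.
Proof.
move=> r1 s0 t0; have [ts|st] := leP t s.
  by rewrite (le_trans ts)// lerDl mulr_ge0 ?powR_ge0.
rewrite (@le_trans _ _ (s `^ (1 - r) * t `^ r))//; last by rewrite lerDr ltW.
have t0' : 0 < t by apply: lt_trans st.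
rewrite -[leLHS](powRr1 t0) -[in leLHS](subrK r 1) powRD ?(gt_eqF t0') ?implybT//.
rewrite ler_wpM2r ?powR_ge0// -(opprB r 1) !powRN lef_pV2 ?posrE ?powR_gt0//.
by rewrite ge0_ler_powR ?nnegrE// ?(ltW s0) ?(ltW st)// subr_ge0.
Qed.

(** * Integration of non-measurable functions, and independence *)

(* [F] is merely convex in [x], so the Frank-Wolfe gap need not be a measurable
   function of the iterate: its expectation is a lower integral, which is still
   monotone and superadditive. *)
Section LowerIntegral.
Local Open Scope ereal_scope.
Context d (T : measurableType d) (R : realType) (mu : {measure set T -> \bar R}).
Implicit Types f g : T -> \bar R.
Import HBNNSimple.

Lemma ge0_le_integral_nomeas f g : (forall x, 0 <= f x) ->
  (forall x, f x <= g x) -> \int[mu]_x f x <= \int[mu]_x g x.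
Proof.
move=> f0 fg; have g0 x : 0 <= g x by rewrite (le_trans _ (fg x)).
rewrite !ge0_integralTE//; apply: ge_ereal_sup => _ [h hf <-].
by apply: ereal_sup_ubound; exists h => // x; rewrite (le_trans (hf x)).
Qed.

(** The sum of a simple function below [f] and one below [g] is a simple function below [f + g]. The
    two suprema are then taken one after the other. *)
Lemma ge0_integralD_nomeas f g : (forall x, 0 <= f x) -> (forall x, 0 <= g x) ->
  \int[mu]_x f x + \int[mu]_x g x <= \int[mu]_x (f x + g x).
Proof.
move=> f0 g0; have fg0 x : 0 <= f x + g x by rewrite adde_ge0.
set I := leRHS.
have h1 (h k : {nnsfun T >-> R}) : (forall x, (h x)%:E <= f x) ->
    (forall x, (k x)%:E <= g x) -> sintegral mu h + sintegral mu k <= I.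
  move=> hf kg; rewrite -sintegralD /I ge0_integralTE//.
  apply: ereal_sup_ubound; exists (add_nnsfun h k) => //= x.
  by rewrite EFinD leeD.
have I0 : 0 <= I by rewrite integral_ge0.
(* Moving one summand to the other side requires finite values, hence the separate case of an
   infinite right side. *)
have [Iy|Ify] := eqVneq I +oo; first by rewrite Iy leey.
have h2 (h : {nnsfun T >-> R}) : (forall x, (h x)%:E <= f x) ->
    \int[mu]_x g x <= I - sintegral mu h.
  move=> hf; rewrite ge0_integralTE//; apply: ge_ereal_sup => _ [k kg <-].
  have hk := h1 _ _ hf kg.
  have k0 : 0 <= sintegral mu k by exact: sintegral_ge0.
  have h0 : 0 <= sintegral mu h by exact: sintegral_ge0.
  have hI : sintegral mu h \is a fin_num.
    rewrite ge0_fin_numE// (le_lt_trans _ (_ : I < +oo))// ?ltey//.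
    by rewrite (le_trans _ hk)// leeDl.
  by rewrite leeBrDr// addeC.
have h00 : \int[mu]_x g x <= I.
  have := h2 nnsfun0; rewrite sintegral0 sube0; apply => x; exact: f0.
have gfin : \int[mu]_x g x \is a fin_num.
  rewrite ge0_fin_numE ?integral_ge0// (le_lt_trans h00)// ltey//.
rewrite -leeBrDr//; rewrite ge0_integralTE//; apply: ge_ereal_sup => _ [h hf <-].
have h0 : 0 <= sintegral mu h by exact: sintegral_ge0.
have hI : sintegral mu h \is a fin_num.
  rewrite ge0_fin_numE// (le_lt_trans _ (_ : I < +oo))// ?ltey//.
  have k0 : forall x, (nnsfun0 x)%:E <= g x by move=> x; exact: g0.
  by have := h1 _ _ hf k0; rewrite sintegral0 adde0.
rewrite leeBrDr// addeC -leeBrDr//; exact: h2.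
Qed.

Lemma ge0_integral_sum_nomeas (I : eqType) (s : seq I) (F : I -> T -> \bar R) :
  (forall i x, i \in s -> 0 <= F i x) ->
  \sum_(i <- s) \int[mu]_x F i x <= \int[mu]_x \sum_(i <- s) F i x.
Proof.
elim: s => [|i s ih] F0.
  by rewrite big_nil integral_ge0// => x _; rewrite big_nil.
rewrite big_cons; under [X in _ <= X]eq_integral => x _ do rewrite big_cons.
have Fs0 j x : j \in s -> 0 <= F j x by move=> js; rewrite F0// inE js orbT.
rewrite (le_trans _ (ge0_integralD_nomeas _ _))//.
- by rewrite leeD2l// ih.
- by move=> x; rewrite F0// mem_head.
- by move=> x; rewrite big_seq sume_ge0// => j; exact: Fs0.
Qed.

(** The constant is taken out of the integral of the measurable [f], after which monotonicity
    suffices. This serves for [g] a power of the operator norm of the Hessian noise, a supremum over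
    a whole sphere. *)
Lemma ge0_le_integralZl_nomeas (c : R) f g : measurable_fun setT f ->
  (forall x, 0 <= f x) -> (forall x, 0 <= g x) -> (0 < c)%R ->
  (forall x, f x <= c%:E * g x) -> \int[mu]_x f x <= c%:E * \int[mu]_x g x.
Proof.
move=> mf f0 g0 c0 fg; have ci0 : (0 <= c^-1)%R by rewrite invr_ge0 ltW.
have -> : \int[mu]_x f x = c%:E * \int[mu]_x (c^-1%:E * f x).
  by rewrite ge0_integralZl// muleA -EFinM mulfV ?gt_eqF// mul1e.
rewrite lee_wpmul2l ?lee_fin ?(ltW c0)//; apply: ge0_le_integral_nomeas => x.
  by rewrite mule_ge0.
rewrite (le_trans (lee_wpmul2l _ (fg x))) ?lee_fin//.
by rewrite muleA -EFinM mulVf ?gt_eqF// mul1e.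
Qed.

End LowerIntegral.

Section IndependentTonelli.
Local Open Scope ereal_scope.
Context dO d1 d2 (Omega : measurableType dO) (T1 : measurableType d1)
  (T2 : measurableType d2) (R : realType) (P : probability Omega R)
  (mu : probability T2 R) (phi : {mfun Omega >-> T1}) (u : {mfun Omega >-> T2}).
Hypothesis indep : forall A B, measurable A -> measurable B ->
  P (phi @^-1` A `&` u @^-1` B) = P (phi @^-1` A) * mu B.

(** Plays the role of conditioning on [phi]: independence on rectangles makes the law of the pair a
    product measure, and Tonelli integrates [u] first. *)
Lemma indep_tonelli (f : T1 * T2 -> \bar R) : measurable_fun setT f ->
  (forall q, 0 <= f q) ->
  \int[P]_w f (phi w, u w) = \int[P]_w \int[mu]_t f (phi w, t).
Proof.
move=> mf f0.
have mp : measurable_fun setT (fun w => (phi w, u w)).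
  by apply: measurable_fun_pair.
pose p : {mfun Omega >-> (T1 * T2)%type} :=
  HB.pack (fun w => (phi w, u w)) (isMeasurableFun.Build _ _ _ _ _ mp).
transitivity (\int[pushforward P p]_q f q).
  by rewrite ge0_integral_pushforward//= preimage_setT.
transitivity (\int[pushforward P phi \x mu]_q f q).
  apply: eq_measure_integral => A mA _; apply/esym.
    by apply: (@product_measure_unique _ _ _ _ _ (distribution P phi) mu).
rewrite (@fubini_tonelli1 _ _ _ _ _ (distribution P phi) mu)//.
rewrite ge0_integral_pushforward//=.
- exact: (@measurable_fun_fubini_tonelli_F _ _ _ _ _ mu).
- by move=> x _; apply: integral_ge0.
Qed.

End IndependentTonelli.

(** A pi-system argument: finite intersections of events indexed by [S] generate the sigma-algebra,
    and on them the finite measures P(. [&] B) and P(B) P(.) agree by mutual independence. *)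
Lemma indep_generated (R : realType) dO (Omega : measurableType dO)
    (P : probability Omega R) (I : choiceType) (E : I -> set (set Omega))
    (S : set I) (t : I) (A B : set Omega) :
  mutually_independent P E ->
  (forall i, E i `<=` measurable) -> (forall i, setI_closed (E i)) ->
  (forall i, E i setT) -> ~ S t ->
  <<s \bigcup_(i in S) E i >> A -> E t B ->
  (P (A `&` B) = P A * P B)%E.
Proof.
move=> indep Em EI ET St SA EB.
have mB : measurable B by exact: (Em t).
pose G : set (set Omega) := [set C | exists (F : {fset I}) (C_ : I -> set Omega),
  [/\ [set` F] `<=` S, forall i, E i (C_ i) & C = \bigcap_(i in [set` F]) C_ i]].
have GE i C : S i -> E i C -> G C.
  move=> Si EC; exists [fset i]%fset, (fun j => if j == i then C else setT).
  split.
  - by move=> j /=; rewrite inE => /eqP ->.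
  - by move=> j; case: eqP => // ->.
  - apply/seteqP; split=> [w Cw j /=|w /(_ i)].
      by rewrite inE => ->.
    by rewrite /= inE eqxx; exact.
have GI : setI_closed G.
  move=> _ _ [F [C [FS EC ->]]] [F' [C' [FS' EC' ->]]].
  (* An index missing from one of the two families contributes the whole space. *)
  exists (F `|` F')%fset,
    (fun i => (if i \in F then C i else setT) `&` (if i \in F' then C' i else setT)).
  split.
  - by move=> j /=; rewrite inE => /orP[/FS|/FS'].
  - by move=> j; apply: EI; case: ifP.
  - apply/seteqP; split=> [w [Cw Cw'] j /= _|w Cw].
      by split; case: ifPn => // jF; [exact: Cw|exact: Cw'].
    by split=> j /= jF; have /= := Cw j; rewrite inE jF ?orbT => /(_ erefl)[].
have mG : G `<=` measurable.
  move=> _ [F [C [FS EC ->]]]; apply: fin_bigcap_measurable => // i _.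
  exact: (Em i).
have GT : G setT.
  exists fset0, (fun=> setT); split=> //; apply/seteqP; split=> //.
have sG : <<s \bigcup_(i in S) E i >> `<=` <<s G >>.
  apply: smallest_sub; first exact: smallest_sigma_algebra.
  by move=> C [i Si EC]; apply: sub_sigma_algebra; exact: GE Si EC.
pose b : {nonneg R} := NngNum (fine_ge0 (measure_ge0 P B)).
have bE : P B = b%:num%:E by rewrite /= fineK// fin_num_measure.
have uniq := @g_sigma_algebra_measure_unique _ R Omega G mG (fun=> setT) (fun=> GT)
   _ (mrestr P mB) (mscale b P) GI.
rewrite bE muleC; apply: uniq => //; last exact: sG.
- by rewrite bigcup_const.
- move=> _ [F [C [FS EC ->]]].
  set CC := \bigcap_(i in _) _; change (P (CC `&` B) = b%:num%:E * P CC)%E; rewrite -bE {}/CC.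
  have tF : t \notin F by apply/negP => /FS.
  pose C' i := if i == t then B else C i.
  have EC' i : E i (C' i) by rewrite /C'; case: eqP => [->|].
  have := indep (t |` F)%fset C' (fun i _ => EC' i).
  have := indep F C (fun i _ => EC i).
  rewrite big_fsetU1//= => -> h; transitivity (P (\bigcap_(i in [set` (t |` F)%fset]) C' i)).
    congr (P _); apply/seteqP; split=> [w [Cw Bw] i /=|w Cw].
      by rewrite !inE /C'; case: eqP => //= _; exact: Cw.
    split=> [i /= iF|].
      have := Cw i; rewrite /= !inE iF orbT /C' => /(_ erefl).
      by case: eqP iF tF => // -> ->.
    by have := Cw t; rewrite /= !inE eqxx /C' eqxx; exact.
  rewrite h {1}/C' eqxx; congr (_ * _)%E; rewrite big_seq [RHS]big_seq.
  apply: eq_bigr => i iF; rewrite /C'; case: eqP => // it.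
  by move: iF tF; rewrite it => ->.
- by move=> k; rewrite /= /mrestr setTI -ge0_fin_numE// fin_num_measure.
Qed.

(** * Centered increments *)

Section MeasurableMatrix.
Context d (T : measurableType d) (R : realType) (D : set T) (m p : nat).
Implicit Types A B : T -> 'M[R]_(m, p).

Definition mx_measurable A := forall i j, measurable_fun D (fun w => A w i j).

Lemma mx_measurableD A B : mx_measurable A -> mx_measurable B ->
  mx_measurable (fun w => A w + B w).
Proof.
move=> mA mB i j; under eq_fun do rewrite mxE.
exact: measurable_funD.
Qed.

Lemma mx_measurable_scale (c : T -> R) A : measurable_fun D c ->
  mx_measurable A -> mx_measurable (fun w => c w *: A w).
Proof.
move=> mc mA i j; under eq_fun do rewrite mxE.
exact: measurable_funM.
Qed.

Lemma mx_measurable_cst (A : 'M[R]_(m, p)) : mx_measurable (fun=> A).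
Proof. by move=> i j; exact: measurable_cst. Qed.

Lemma mx_measurableZ c A : mx_measurable A -> mx_measurable (fun w => c *: A w).
Proof. exact: mx_measurable_scale. Qed.

Lemma mx_measurableB A B : mx_measurable A -> mx_measurable B ->
  mx_measurable (fun w => A w - B w).
Proof.
move=> mA mB; under eq_fun do rewrite -scaleN1r.
by apply: mx_measurableD => //; exact: mx_measurableZ.
Qed.

Lemma measurable_fdot A B : mx_measurable A -> mx_measurable B ->
  measurable_fun D (fun w => fdot (A w) (B w)).
Proof.
move=> mA mB; rewrite /fdot.
apply: measurable_sum => i; apply: measurable_sum => j.
exact: measurable_funM.
Qed.

Lemma measurable_fnorm A : mx_measurable A ->
  measurable_fun D (fun w => fnorm (A w)).
Proof.
move=> mA; have -> : (fun w => fnorm (A w)) = (fun w => Num.sqrt (fdot (A w) (A w))).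
  by apply/funext => w; rewrite -sqr_fnorm sqrtr_sqr ger0_norm// fnorm_ge0.
apply: measurableT_comp; last exact: measurable_fdot.
by apply: continuous_measurable_fun; exact: sqrt_continuous.
Qed.

Lemma measurable_powR_fnorm (r : R) A : mx_measurable A ->
  measurable_fun D (fun w => (fnorm (A w) `^ r)%:E).
Proof.
move=> mA; apply/measurable_EFinP.
by apply: (measurableT_comp (measurable_powR _)); exact: measurable_fnorm.
Qed.

End MeasurableMatrix.

Section Centered.
Context d (T : measurableType d) (R : realType) (mu : probability T R) (m p : nat).
Implicit Types g : T -> 'M[R]_(m, p).

Lemma is_mean_measurable g A : is_mean mu g A -> mx_measurable setT g.
Proof. by move=> gA i j; have [/measurable_int/measurable_EFinP] := gA i j. Qed.

Lemma is_meanB g A B : is_mean mu g A -> is_mean mu (fun t => g t - B) (A - B).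
Proof.
move=> gA i j; have [gi gE] := gA i j; rewrite !mxE.
have ci := finite_measure_integrable_cst mu (- B i j) measurableT.
under eq_fun do rewrite !mxE.
split; first exact: (integrableD measurableT gi ci).
move: gE; rewrite unlock => gE.
rewrite (_ : (fun w => _) = (EFin \o (fun t => g t i j)) \+ (EFin \o cst (- B i j)))//.
by rewrite integralD_EFin// gE /= integral_cst//= probability_setT mule1.
Qed.

Lemma is_meanZ c g A : is_mean mu g A -> is_mean mu (fun t => c *: g t) (c *: A).
Proof.
move=> gA i j; have [gi gE] := gA i j; rewrite !mxE.
under eq_fun do rewrite !mxE.
split; first by have := integrableZl measurableT c gi.
move: gE; rewrite unlock => gE; rewrite EFinM -gE -integralZl//.
Qed.

Lemma integral_fdot_centered (e : 'M[R]_(m, p)) g : is_mean mu g 0 ->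
  mu.-integrable setT (EFin \o (fun t => fdot e (g t))) /\
  (\int[mu]_t (fdot e (g t))%:E = 0)%E.
Proof.
move=> g0; rewrite /fdot.
have gi i j : mu.-integrable setT (fun t => (e i j * g t i j)%:E).
  by have [gi _] := g0 i j; have := integrableZl measurableT (e i j) gi.
have si i : mu.-integrable setT (fun t => (\sum_j e i j * g t i j)%:E).
  by under eq_fun do rewrite -sumEFin; exact: integrable_sum.
rewrite /comp; split.
  by under eq_fun do rewrite -sumEFin; exact: integrable_sum.
under eq_integral do rewrite -sumEFin.
rewrite integral_sum// big1// => i _.
under eq_integral do rewrite -sumEFin.
rewrite integral_sum// big1// => j _.
have [gij] := g0 i j; rewrite unlock mxE => gE.
by under eq_integral do rewrite EFinM; rewrite integralZl// gE mule0.
Qed.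

Lemma integral_powR_fnormD (r : R) (e : 'M[R]_(m, p)) g (c : R) :
  1 < r <= 2 -> is_mean mu g 0 ->
  (\int[mu]_t (fnorm (g t) `^ r)%:E <= c%:E)%E ->
  (\int[mu]_t (fnorm (e + g t) `^ r)%:E <= (fnorm e `^ r + 6 * c)%:E)%E.
Proof.
move=> r12 g0 gc; have mg := is_mean_measurable g0.
have [di dE] := integral_fdot_centered e g0.
have mgr := measurable_powR_fnorm r mg.
have gri : mu.-integrable setT (fun t => (fnorm (g t) `^ r)%:E).
  apply/integrableP; split=> //; rewrite (le_lt_trans _ (ltry c))//.
  by under eq_integral do rewrite gee0_abs ?lee_fin ?powR_ge0//.
pose k := r * fnorm e `^ (r - 2).
pose b1 : T -> \bar R := EFin \o cst (fnorm e `^ r).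
pose b2 t := (k%:E * (fdot e (g t))%:E)%E.
have [six sixE] : exists s : R, s = 6 by exists 6.
pose b3 t := (six%:E * (fnorm (g t) `^ r)%:E)%E.
have i1 : mu.-integrable setT b1 by exact: finite_measure_integrable_cst.
have i2 : mu.-integrable setT b2 := integrableZl measurableT k di.
have i3 : mu.-integrable setT b3 := integrableZl measurableT six gri.
have i12 := integrableD measurableT i1 i2.
have i123 := integrableD measurableT i12 i3.
have le t : ((fnorm (e + g t) `^ r)%:E <= b1 t + b2 t + b3 t)%E.
  by rewrite /b1 /b2 /b3 /= -!EFinM sixE -!EFinD lee_fin powR_fnormD.
have eri : mu.-integrable setT (fun t => (fnorm (e + g t) `^ r)%:E).
  apply: (le_integrable measurableT _ _ i123).
    apply: measurable_powR_fnorm.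
    exact: (mx_measurableD (mx_measurable_cst e) mg).
  move=> t _; have p0 : (0 <= (fnorm (e + g t) `^ r)%:E)%E by rewrite lee_fin powR_ge0.
  by rewrite (gee0_abs p0) (le_trans (le t))// lee_abs.
have := le_integral measurableT eri i123 (fun t _ => le t); move/le_trans; apply.
rewrite (integralD measurableT i12 i3) (integralD measurableT i1 i2).
rewrite (integralZl measurableT di) (integralZl measurableT gri) dE mule0 adde0.
have -> : (\int[mu]_x b1 x = (fnorm e `^ r)%:E)%E.
  transitivity (\int[mu]_x cst (fnorm e `^ r)%:E x)%E => //.
  by rewrite integral_cst//= probability_setT mule1.
rewrite sixE [leRHS]EFinD leeD2l// EFinM.
by rewrite lee_pmul2l// lte_fin.
Qed.

End Centered.

(* By independence of [phi] and [u], the increment [g (phi w) (u w)] is centered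
   conditionally on [phi]. *)
Lemma powR_fnorm_martingale_step dO d1 d2 (Omega : measurableType dO)
    (T1 : measurableType d1) (T2 : measurableType d2) (R : realType)
    (P : probability Omega R) (mu : probability T2 R)
    (phi : {mfun Omega >-> T1}) (u : {mfun Omega >-> T2}) m p (r c : R)
    (e : T1 -> 'M[R]_(m, p)) (g : T1 -> T2 -> 'M[R]_(m, p)) :
  (forall A B, measurable A -> measurable B ->
     P (phi @^-1` A `&` u @^-1` B) = P (phi @^-1` A) * mu B)%E ->
  1 < r <= 2 ->
  mx_measurable setT e -> mx_measurable setT (fun q => g q.1 q.2) ->
  (forall w, is_mean mu (g w) 0) ->
  (forall w, \int[mu]_t (fnorm (g w t) `^ r)%:E <= c%:E)%E ->
  (\int[P]_w (fnorm (e (phi w) + g (phi w) (u w)) `^ r)%:E <=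
   \int[P]_w (fnorm (e (phi w)) `^ r)%:E + (6 * c)%:E)%E.
Proof.
move=> indep r12 me mg g0 gc.
pose f (q : T1 * T2) := (fnorm (e q.1 + g q.1 q.2) `^ r)%:E.
have mf : measurable_fun setT f.
  apply: measurable_powR_fnorm; apply: mx_measurableD => //.
  by move=> i j; apply: (measurableT_comp (me i j)).
rewrite -[leLHS]/(\int[P]_w f (phi w, u w))%E.
have f0 q : (0 <= f q)%E by rewrite lee_fin powR_ge0.
rewrite (indep_tonelli indep)//.
pose h x := (\int[mu]_t f (x, t))%E.
have mh : measurable_fun setT h.
  exact: (@measurable_fun_fubini_tonelli_F _ _ _ _ _ mu f mf f0).
have mhphi : measurable_fun setT (h \o phi) by apply: measurableT_comp.
have mep : measurable_fun setT (fun w => (fnorm (e (phi w)) `^ r)%:E).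
  by apply: measurable_powR_fnorm => i j; apply: (measurableT_comp (me i j)).
(* The moment bound at a single point of the space already forces its right side to be
   nonnegative. *)
have c0 : 0 <= c.
  rewrite -lee_fin (le_trans _ (gc (phi point)))// integral_ge0// => t _.
  by rewrite lee_fin powR_ge0.
apply: (@le_trans _ _ (\int[P]_w ((fnorm (e (phi w)) `^ r)%:E + (6 * c)%:E))%E).
  apply: ge0_le_integral => //.
  - by move=> w _; apply: integral_ge0.
  - exact: (emeasurable_funD mep (measurable_cst _)).
  - move=> w _; exact: (integral_powR_fnormD (e (phi w)) r12 (g0 (phi w)) (gc (phi w))).
rewrite ge0_integralD//.
- by rewrite integral_cst//= probability_setT mule1.
- by move=> w _; rewrite lee_fin powR_ge0.
- by move=> w _; rewrite lee_fin mulr_ge0.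
Qed.

(** * Calculus along segments *)

Section OperatorNorm.
Context {R : realType} {d m p : nat}.

Lemma linear_sum_delta (T : {linear 'cV[R]_d -> 'M[R]_(m, p)}) h :
  T h = \sum_(i < d) h i 0 *: T (delta_mx i 0).
Proof.
rewrite [in LHS](matrix_sum_delta h) linear_sum; apply: eq_bigr => i _.
by rewrite zmodp.big_ord1 linearZ.
Qed.

(** Either the set of norms has a supremum, which dominates a nonnegative element, or [sup] takes
    its default value 0. *)
Lemma opnorm_ge0 (T : 'cV[R]_d -> 'M[R]_(m, p)) : 0 <= opnorm T.
Proof.
rewrite /opnorm; set A := [set _ | _ in _].
have [[[a Aa] Aub]|/sup_out ->//] := pselect (has_sup A).
rewrite (@le_trans _ _ a)//; last by apply: sup_upper_bound => //; split=> //; exists a.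
by case: Aa => h _ <-; exact: fnorm_ge0.
Qed.

(** By linearity the values on the unit sphere are bounded by the sum of the norms at the basis
    vectors, so the [sup] is a genuine upper bound. *)
Lemma ler_opnorm (T : {linear 'cV[R]_d -> 'M[R]_(m, p)}) h :
  fnorm (T h) <= opnorm T * fnorm h.
Proof.
have [/fnorm_eq0 ->|h0] := eqVneq (fnorm h) 0.
  by rewrite linear0 !fnorm0 mulr0.
have hgt0 : 0 < fnorm h by rewrite lt_neqAle eq_sym h0 fnorm_ge0.
rewrite -ler_pdivrMr// mulrC -[(fnorm h)^-1]ger0_norm ?invr_ge0 ?fnorm_ge0//.
rewrite -fnormZ -linearZ; apply: ub_le_sup.
  exists (\sum_(i < d) fnorm (T (delta_mx i 0))) => _ [k k1 <-].
  rewrite linear_sum_delta (le_trans (ler_fnorm_sum _ _ _))//.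
  apply: ler_sum => i _; rewrite fnormZ ler_piMl ?fnorm_ge0// -k1.
  exact: ler_fnorm_entry.
exists ((fnorm h)^-1 *: h) => //=.
by rewrite fnormZ ger0_norm ?invr_ge0 ?fnorm_ge0// mulVf.
Qed.

End OperatorNorm.

Section Segment.
Context {R : realType} {d m p : nat}.
Variables (X : set 'cV[R]_d) (g : 'cV[R]_d -> 'M[R]_(m, p))
  (Dg : 'cV[R]_d -> 'cV[R]_d -> 'M[R]_(m, p)).
Hypotheses (X_convex : convex_set X) (g_der : has_derivative_on X g Dg)
  (DgZ : forall z c h, Dg z (c *: h) = c *: Dg z h).

Lemma convex_set_comb x y (t : R) : X x -> X y -> 0 <= t <= 1 ->
  X ((1 - t) *: x + t *: y).
Proof.
move=> Xx Xy /andP[t0 t1].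
have := X_convex (Itv01 t0 t1) (mem_set Xy) (mem_set Xx).
by move=> /set_mem; rewrite addrC.
Qed.

Lemma convex_set_segment x y (t : R) : X x -> X y -> 0 <= t <= 1 ->
  X (x + t *: (y - x)).
Proof.
move=> Xx Xy t01; have := convex_set_comb Xx Xy t01.
by rewrite scalerBl scalerBr scale1r addrA addrAC.
Qed.

Context (x y : 'cV[R]_d) (Xx : X x) (Xy : X y).
Let c t := x + t *: (y - x).

(** Convexity keeps [c s] in [X], where the relative derivative speaks. The 1 added to the norm of
    [y - x] covers the case x = y. *)
Lemma has_derivative_segment (t e : R) : 0 <= t <= 1 -> 0 < e ->
  \forall s \near t, 0 <= s <= 1 ->
    fnorm (g (c s) - g (c t) - (s - t) *: Dg (c t) (y - x)) <=
    e * `|s - t|.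
Proof.
move=> t01 e0; have k0 : 0 < e / (fnorm (y - x) + 1).
  by rewrite divr_gt0// ltr_wpDl// fnorm_ge0.
have := g_der (convex_set_segment Xx Xy t01) k0.
rewrite nearE/= => near_c.
have cc : c s @[s --> t] --> c t.
  rewrite /c; apply: cvgD; first exact: cvg_cst.
  by apply: cvgZr_tmp; exact: cvg_id.
have {near_c} := cc _ near_c.
apply: (@filterS _ (nbhs t)) => s h s01.
have {h} := h (convex_set_segment Xx Xy s01); rewrite -/(c s) -/(c t).
have -> : c s - c t = (s - t) *: (y - x).
  by rewrite /c opprD addrACA subrr add0r scalerBl.
rewrite DgZ fnormZ => /le_trans; apply.
rewrite mulrCA [leRHS]mulrC ler_wpM2l ?normr_ge0//.
rewrite -mulrA ler_piMr ?(ltW e0)// mulrC ler_pdivrMr ?mul1r ?lerDl ?ler01//.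
by rewrite ltr_wpDl ?fnorm_ge0.
Qed.

(** Pairing with a fixed [v] gives a real function of one variable, to which the mean value theorem
    and the fundamental theorem of calculus apply. *)
Lemma near_fdot_segment (v : 'M[R]_(m, p)) (t e : R) : 0 <= t <= 1 -> 0 < e ->
  \forall s \near t, 0 <= s <= 1 ->
    `|fdot v (g (c s)) - fdot v (g (c t)) - (s - t) * fdot v (Dg (c t) (y - x))|
    <= e * `|s - t|.
Proof.
move=> t01 e0; have k0 : 0 < e / (fnorm v + 1).
  by rewrite divr_gt0// ltr_wpDl// fnorm_ge0.
have := has_derivative_segment t01 k0.
apply: (@filterS _ (nbhs t)) => s h s01.
rewrite -fdotZr -!fdotBr (le_trans (ler_norm_fdot _ _))//.
rewrite (le_trans (ler_wpM2l (fnorm_ge0 v) (h s01)))// mulrA ler_wpM2r ?normr_ge0//.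
rewrite mulrCA ler_piMr ?(ltW e0)// ler_pdivrMr ?mul1r ?lerDl ?ler01//.
by rewrite ltr_wpDl ?fnorm_ge0.
Qed.

(** For an interior [t] every nearby parameter lies in [0, 1], so the derivative relative to the
    segment is an ordinary two-sided one. *)
Lemma fdot_segment_is_derive (v : 'M[R]_(m, p)) (t : R) : 0 < t < 1 ->
  is_derive t 1 (fun s => fdot v (g (c s)) : R) (fdot v (Dg (c t) (y - x))).
Proof.
move=> t01; set D := fdot v _; set psi := fun s : R => _.
have t01' : 0 <= t <= 1 by case/andP: t01 => /ltW -> /ltW ->.
have lim_psi : (fun h => h^-1 *: ((psi \o shift t) (h *: (1 : R)) - psi t)) @ 0^' --> D.
  apply/cvgrPdist_le => e e0.
  have h1 := near_fdot_segment v t01' e0.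
  have h2 : \forall s \near t, 0 <= s <= 1.
    near=> s; apply/andP; split; apply: ltW; near: s.
      by apply: lt_nbhsr; case/andP: t01.
    by apply: lt_nbhsl; case/andP: t01.
  have h3 : \forall s \near t,
      `|psi s - psi t - (s - t) * D| <= e * `|s - t|.
    by near=> s; apply: (near h1 s) => //; apply: (near h2 s).
  have h4 : \forall h \near (0 : R), `|psi (h + t) - psi t - h * D| <= e * `|h|.
    have ct : (h + t) @[h --> (0 : R)] --> t.
      by rewrite -[X in _ --> X]add0r; apply: cvgD; [exact: cvg_id|exact: cvg_cst].
    have := ct _ h3; apply: (@filterS _ (nbhs (0 : R))) => h /=.
    by rewrite addrK.
  near=> h; have h0 : h != 0 by near: h; exact: nbhs_dnbhs_neq.
  have : `|psi (h + t) - psi t - h * D| <= e * `|h|.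
    by near: h; apply: nbhs_dnbhs.
  have -> : psi (h + t) - psi t - h * D =
            h * (h^-1 *: ((psi \o shift t) (h *: (1 : R)) - psi t) - D).
    rewrite mulrBr /= /GRing.scale/= mulr1 mulrA mulfV// mul1r//.
  by rewrite normrM mulrC ler_pM2r ?normr_gt0// distrC.
by apply: DeriveDef; [apply/cvg_ex; exists D|apply/cvg_lim].
Unshelve. all: by end_near.
Qed.

Lemma fdot_segment_LR (v : 'M[R]_(m, p)) :
  derivable_oo_LRcontinuous (fun s => fdot v (g (c s)) : R) 0 1.
Proof.
have cont (t : R) : 0 <= t <= 1 -> forall e : R, 0 < e -> \forall s \near t, 0 <= s <= 1 ->
    `|fdot v (g (c t)) - fdot v (g (c s))| <= e.
  move=> t01 e e0; set D := fdot v (Dg (c t) (y - x)).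
  have h1 := near_fdot_segment v t01 ltr01.
  have k0 : 0 < e / (`|D| + 1) by rewrite divr_gt0// ltr_wpDl.
  have h2 : \forall s \near t, `|s - t| <= e / (`|D| + 1).
    near=> s; rewrite distrC; near: s; apply/nbhs_normP.
    by exists (e / (`|D| + 1)) => //= z /= /ltW.
  near=> s => s01.
  have := near h1 s _ s01; rewrite mul1r => /(_ _) h.
  have {}h : `|fdot v (g (c s)) - fdot v (g (c t)) - (s - t) * D| <= `|s - t| by apply: h.
  have h3 : `|s - t| <= e / (`|D| + 1) by near: s.
  rewrite distrC -[X in `|X|](subrK ((s - t) * D)) (le_trans (ler_normD _ _))//.
  rewrite normrM (le_trans (lerD h (lexx _)))//.
  by move: h3; rewrite ler_pdivlMr ?ltr_wpDl// mulrDr mulr1 addrC.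
split.
- move=> t; rewrite in_itv/= => t01.
  exact: (@ex_derive _ _ _ _ _ _ _ (fdot_segment_is_derive v t01)).
- apply/cvgrPdist_le => e e0.
  have h := cont 0 (introT andP (conj (lexx _) ler01)) _ e0.
  near=> s.
  have hs : 0 <= s <= 1 -> `|fdot v (g (c 0)) - fdot v (g (c s))| <= e.
    by near: s; apply: cvg_within; exact: h.
  by apply: hs; apply/andP; split; near: s; [exact: nbhs_right_ge|exact: nbhs_right_le].
- apply/cvgrPdist_le => e e0.
  have h := cont 1 (introT andP (conj ler01 (lexx _))) _ e0.
  near=> s.
  have hs : 0 <= s <= 1 -> `|fdot v (g (c 1)) - fdot v (g (c s))| <= e.
    by near: s; apply: cvg_within; exact: h.
  by apply: hs; apply/andP; split; near: s; [exact: nbhs_left_ge|exact: nbhs_left_le].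
Unshelve. all: by end_near.
Qed.

(** The vector-valued mean value inequality: with v = g y - g x, the scalar theorem gives |v|^2 =
    <v, Dg (c t) (y - x)> for some [t], and Cauchy-Schwarz cancels one factor |v|. *)
Lemma ler_fnorm_segment (M : R) :
  (forall t, 0 <= t <= 1 -> fnorm (Dg (c t) (y - x)) <= M) ->
  fnorm (g y - g x) <= M.
Proof.
move=> DM; have M0 : 0 <= M.
  by rewrite (le_trans (fnorm_ge0 _) (DM 0 _))// lexx ler01.
have [->|v0] := eqVneq (fnorm (g y - g x)) 0; first by [].
have vgt0 : 0 < fnorm (g y - g x) by rewrite lt_neqAle eq_sym v0 fnorm_ge0.
have [t] := MVT (@ltr01 R)
  (fun t t01 => @fdot_segment_is_derive (g y - g x) t t01)
  (derivable_oo_LRcontinuous_within (fdot_segment_LR (g y - g x))).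
rewrite in_itv/= => /andP[/ltW t0 /ltW t1].
have -> : c 1 = y by rewrite /c scale1r addrC subrK.
have -> : c 0 = x by rewrite /c scale0r addr0.
rewrite -fdotBr -sqr_fnorm subr0 mulr1 expr2 => h.
rewrite -(ler_pM2l vgt0) h (le_trans (ler_fdot _ _))// ler_wpM2l ?fnorm_ge0//.
by apply: DM; rewrite t0.
Qed.

End Segment.

Section Clip.
Context {R : realType}.

(* The law of alpha lives on the whole line, whereas the Hessian only makes
   sense on the segment, i.e. for parameters in [0, 1]. *)
Definition clip01 (a : R) : R := Num.max 0 (Num.min a 1).

Lemma clip01_itv a : 0 <= clip01 a <= 1.
Proof.
by rewrite /clip01 le_max lexx/= ge_max ler01/= ge_min lexx orbT.
Qed.

Lemma clip01_id a : 0 <= a <= 1 -> clip01 a = a.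
Proof. by move=> /andP[a0 a1]; rewrite /clip01 min_l// max_r. Qed.

Lemma clip01_continuous : continuous clip01.
Proof.
move=> t.
have h1 : {for t, continuous (fun a : R => (1 : R^o))} by exact: cst_continuous.
have h0 : {for t, continuous (fun a : R => (0 : R^o))} by exact: cst_continuous.
have hid : {for t, continuous (fun a : R => (a : R^o))} by exact: cvg_id.
exact: (continuous_max h0 (continuous_min hid h1)).
Qed.

Lemma measurable_clip01 : measurable_fun setT clip01.
Proof. exact: (continuous_measurable_fun clip01_continuous). Qed.

(** The density is 1 on the unit interval; positive and negative parts are treated separately. *)
Lemma integral_uniform01 (phi : R -> R) : measurable_fun setT phi ->
  (\int[uniform_prob (@ltr01 R)]_a (phi a)%:E =
   \int[lebesgue_measure]_(a in `[0%R, 1%R]) (phi a)%:E)%E.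
Proof.
move=> mphi; have mE : measurable_fun setT (EFin \o phi) by exact/measurable_EFinP.
rewrite integralE [RHS]integralE.
rewrite !integral_uniform//.
- by rewrite subr0 invr1 !mul1e.
- exact: measurable_funeneg.
- exact: measurable_funepos.
Qed.

End Clip.

Section SegmentMean.
Context {R : realType} {d m p : nat}.
Variables (X : set 'cV[R]_d) (g : 'cV[R]_d -> 'M[R]_(m, p))
  (Dg : 'cV[R]_d -> 'cV[R]_d -> 'M[R]_(m, p)).
Hypotheses (X_convex : convex_set X) (g_der : has_derivative_on X g Dg)
  (DgZ : forall z c h, Dg z (c *: h) = c *: Dg z h).
Context (x y : 'cV[R]_d) (Xx : X x) (Xy : X y) (M : R).
Let c t := x + t *: (y - x).
Hypothesis Dg_cont : forall z, X z -> forall e : R, 0 < e ->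
  \forall z' \near within X (nbhs z),
    fnorm (Dg z' (y - x) - Dg z (y - x)) <= e.
Hypothesis Dg_bound : forall z, X z -> fnorm (Dg z (y - x)) <= M.

Let Xc a : X (c (clip01 a)).
Proof. exact: (convex_set_segment X_convex Xx Xy (clip01_itv a)). Qed.

Lemma segment_entry_continuous i j :
  continuous (fun a => Dg (c (clip01 a)) (y - x) i j : R).
Proof.
move=> t; apply/cvgrPdist_le => e e0.
have := Dg_cont (Xc t) e0; rewrite nearE/= => near_c.
have cc : c (clip01 s) @[s --> t] --> c (clip01 t).
  rewrite /c; apply: cvgD; first exact: cvg_cst.
  by apply: cvgZr_tmp; exact: clip01_continuous.
have {near_c} := cc _ near_c.
apply: (@filterS _ (nbhs t)) => s /(_ (Xc s)) h.
by rewrite distrC (le_trans _ h)// (le_trans _ (ler_fnorm_entry _ i j))// !mxE.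
Qed.

(* The fundamental theorem of calculus, read as unbiasedness of the derivative
   at a uniformly drawn point of the segment. *)
Lemma is_mean_segment :
  is_mean (uniform_prob (@ltr01 R)) (fun a => Dg (c (clip01 a)) (y - x)) (g y - g x).
Proof.
move=> i j.
have cphi := @segment_entry_continuous i j.
have mphi := continuous_measurable_fun cphi.
have mE : measurable_fun setT (EFin \o (fun a => Dg (c (clip01 a)) (y - x) i j)).
  exact/measurable_EFinP.
split.
  have ci := finite_measure_integrable_cst (uniform_prob (@ltr01 R)) M measurableT.
  apply: (le_integrable _ _ _ ci) => //.
  move=> a _; rewrite /= lee_fin (le_trans (ler_fnorm_entry _ _ _))//.
  by rewrite (le_trans (Dg_bound _))//; exact: ler_norm.
rewrite unlock integral_uniform01//.
(* Pairing with an elementary matrix reads off one entry. *)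
pose v : 'M[R]_(m, p) := delta_mx i j.
have vE A : fdot v A = A i j.
  rewrite /fdot (bigD1 i)//= (bigD1 j)//= !mxE !eqxx mul1r !big1 ?addr0//.
  - by move=> k /negbTE ki; rewrite big1// => l _; rewrite mxE ki mul0r.
  - by move=> k /negbTE ki; rewrite mxE ki andbF mul0r.
have LR := fdot_segment_LR X_convex g_der DgZ Xx Xy v.
rewrite (continuous_FTC2 ltr01 _ LR).
- by rewrite !vE !mxE scale0r addr0 scale1r [x + _]addrC subrK.
- exact: continuous_subspaceT.
- move=> t; rewrite in_itv/= => t01.
  have dt := fdot_segment_is_derive X_convex g_der DgZ Xx Xy v t01.
  rewrite derive1E derive_val vE clip01_id//.
  by case/andP: t01 => /ltW -> /ltW ->.
Qed.

End SegmentMean.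

(** * Borel measurability *)

Section BorelVectors.
Context {R : realType} {d : nat}.

Let box (q : 'cV[rat]_d) (n : nat) : set 'cV[R]_d :=
  [set v | forall i, `|v i 0 - ratr (q i 0)| < n.+1%:R^-1].

(** Second countability: the boxes have rational centers and radii 1/(n+1), so the union is
    countable. *)
Lemma open_rat_boxes (U : set 'cV[R]_d) : open U ->
  U = \bigcup_(qn in [set qn : 'cV[rat]_d * nat | box qn.1 qn.2 `<=` U]) box qn.1 qn.2.
Proof.
move=> oU; apply/seteqP; split=> [v Uv|v [qn /= sub bv]]; last exact: sub.
have /nbhs_ballP[e /= e0 ve] : nbhs v U by exact: open_nbhs_nbhs.
(* Two points of one box are less than 2/(n+1) apart in each coordinate, hence [e / 2]. *)
have [n ne] : exists n, n.+1%:R^-1 < e / 2 :> R.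
  have e2 : 0 < e / 2 by rewrite divr_gt0.
  have [n _ nE] := near_infty_natSinv_lt (PosNum e2).
  by exists n; apply: (nE n) => /=.
have n0 : 0 < n.+1%:R^-1 :> R by rewrite invr_gt0.
have Q i : exists q : rat, `|v i 0 - ratr q| < n.+1%:R^-1.
  have /rat_in_itvoo[q] : v i 0 - n.+1%:R^-1 < v i 0 + n.+1%:R^-1.
    by rewrite ltrBlDr -addrA ltrDl addr_gt0.
  rewrite in_itv/= => /andP[q1 q2]; exists q.
  move: q1 q2; move: (_^-1) (ratr q) => a b q1 q2.
  by rewrite ltr_norml; apply/andP; split; lra.
have [qf qfE] := choice Q.
pose q : 'cV[rat]_d := \col_i qf i.
have vq : box q n v by move=> i; rewrite mxE.
exists (q, n) => //= w wq; apply: ve; split=> // i j; rewrite (ord1 j) /ball/=.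
have -> : v i 0 - w i 0 = (v i 0 - ratr (q i 0)) - (w i 0 - ratr (q i 0)).
  by rewrite opprB addrA subrK.
rewrite (le_lt_trans (ler_normB _ _))// [ltRHS]splitr ltrD//.
  exact: lt_trans (vq i) ne.
exact: lt_trans (wq i) ne.
Qed.

(** Preimages of boxes are finite intersections of conditions on entries, and every open set is a
    countable union of boxes. *)
Lemma measurable_borel_cV dT (T : measurableType dT) (D : set T) (h : T -> 'cV[R]_d) :
  mx_measurable D h -> measurable_fun D (h : T -> borel_cV R d).
Proof.
move=> mh mD; apply: (@measurability _ _ T (borel_cV R d) D h open _ _ mD) => //.
move=> _ [U oU <-].
rewrite (open_rat_boxes oU) preimage_bigcup setI_bigcupr bigcup_mkcond.
apply: countable_bigcupT_measurable; first exact: countableP.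
move=> [q n]; case: ifP => _ //.
rewrite (_ : _ `&` _ = D `&` \bigcap_(i in [set: 'I_d])
    (D `&` (fun w => h w i 0) @^-1` [set a | `|a - ratr (q i 0)| < n.+1%:R^-1])).
  apply: measurableI => //; apply: fin_bigcap_measurable => // i _.
  apply: mh => //.
  have -> : [set a : R | `|a - ratr (q i 0)| < n.+1%:R^-1] =
      `]ratr (q i 0) - n.+1%:R^-1, ratr (q i 0) + n.+1%:R^-1[%classic.
    by apply/seteqP; split => a /=; rewrite in_itv/= ltr_distl.
  exact: measurable_itv.
apply/seteqP; split=> [w [Dw wb]|w [Dw wb]]; split => //.
  by move=> i _; split => //; exact: wb.
by move=> i; have [] := wb i I.
Qed.

Lemma measurable_compact_borel_cV (X : set 'cV[R]_d) : compact X ->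
  measurable (X : set (borel_cV R d)).
Proof.
move=> cX; rewrite -[X]setCK; apply: measurableC; apply: sub_sigma_algebra.
by apply: closed_openC; apply: compact_closed => //; exact: norm_hausdorff.
Qed.

Lemma continuous_within_mx_measurable (X : set 'cV[R]_d) m p (g : 'cV[R]_d -> 'M[R]_(m, p)) :
  (forall x, X x -> forall e : R, 0 < e ->
     \forall y \near within X (nbhs x), fnorm (g y - g x) <= e) ->
  mx_measurable (X : set (borel_cV R d)) g.
Proof.
move=> gc i j mX.
apply: (@measurability _ _ (borel_cV R d) R X (fun x => g x i j) (@RGenOInfty.G R) _ _ mX).
  exact: RGenOInfty.measurableE.
move=> _ [_ [a ->] <-].
pose B : set R := `]a, +oo[%classic.
(* By continuity relative to [X], the preimage of an open ray is the trace on [X] of an open set. *)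
have -> : X `&` (fun x => g x i j) @^-1` B =
    X `&` [set x | X x -> B (g x i j)]^°.
  apply/seteqP; split=> x [Xx Bx]; split=> //; last first.
    by have := interior_subset Bx; exact.
  have oB : open B by exact: interval_open.
  have /nbhs_ballP[e /= e0 eB] : nbhs (g x i j) B by exact: open_nbhs_nbhs.
  have e2 : 0 < e / 2 by rewrite divr_gt0.
  have := gc x Xx _ e2; rewrite nearE/=.
  apply: (@filterS _ (nbhs x)) => y gy Xy; apply: eB; rewrite /ball/=.
  rewrite distrC (le_lt_trans (_ : _ <= e / 2))//.
    rewrite (le_trans _ (gy Xy))// (le_trans _ (ler_fnorm_entry _ i j))// !mxE//.
  by rewrite ltr_pdivrMr// ltr_pMr// ltr1n.
apply: measurableI => //; apply: sub_sigma_algebra; exact: open_interior.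
Qed.

End BorelVectors.

(** * Smoothness and the descent inequality *)

(** Cauchy-Schwarz on each row, then summation of the squares. *)
Lemma ler_fnorm_mul (R : realType) m p (A : 'M[R]_(m, p)) (h : 'cV[R]_p) :
  fnorm (A *m h) <= fnorm A * fnorm h.
Proof.
rewrite -(ler_pXn2r (n := 2)) ?nnegrE ?mulr_ge0 ?fnorm_ge0//.
rewrite exprMn (sqr_fnorm A) (sqr_fnorm (A *m h)) /fdot mulr_suml.
apply: ler_sum => i _; rewrite zmodp.big_ord1 -expr2.
have -> : (A *m h) i 0 = fdot (row i A)^T h.
  rewrite mxE /fdot; apply: eq_bigr => k _; rewrite zmodp.big_ord1 !mxE//.
have -> : \sum_j A i j * A i j = fdot (row i A)^T (row i A)^T.
  by rewrite /fdot; apply: eq_bigr => k _; rewrite zmodp.big_ord1 !mxE.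
rewrite -sqr_fnorm -exprMn -[leLHS]real_normK ?num_real//.
rewrite ler_pXn2r ?nnegrE ?mulr_ge0 ?fnorm_ge0//; exact: ler_norm_fdot.
Qed.

Lemma compact_fnorm_diameter (R : realType) d (X : set 'cV[R]_d) : compact X ->
  exists2 D, 0 <= D & forall x y, X x -> X y -> fnorm (x - y) <= D.
Proof.
move=> /compact_bounded[M [_ XM]].
have XM1 x : X x -> `|x| <= M + 1 by move=> Xx; apply: (XM _ _ x) => //; rewrite ltrDl.
exists (`|(d * 1)%:R * ((M + 1) *+ 2)|) => // x y Xx Xy.
rewrite (le_trans (ler_fnorm_mx_norm _))// (le_trans _ (ler_norm _))//.
rewrite ler_wpM2l// (le_trans (ler_normB _ _))// mulr2n lerD ?XM1//.
Qed.

Section Smoothness.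
Context {R : realType} {d n : nat}.
Variables (X : set 'cV[R]_d) (f : 'cV[R]_d -> 'cV[R]_n) (J : 'cV[R]_d -> 'M[R]_(n, d))
  (H : 'cV[R]_d -> {linear 'cV[R]_d -> 'M[R]_(n, d)}) (L : R).
Hypotheses (X_convex : convex_set X) (L_ge0 : 0 <= L).

(** The mean value inequality for f - J x, whose derivative at [z] is J z - J x. It yields the
    factor [L] in place of the sharp L/2, which only affects the final constant. *)
Lemma taylor_remainder :
  has_derivative_on X f (fun x h => J x *m h) ->
  (forall x y, X x -> X y -> opnorm (fun h => (J x - J y) *m h) <= L * fnorm (x - y)) ->
  forall x y, X x -> X y ->
  fnorm (f y - f x - J x *m (y - x)) <= L * fnorm (y - x) ^+ 2.
Proof.
move=> f_der J_lip x y Xx Xy.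
pose g z := f z - J x *m z; pose Dg (z h : 'cV[R]_d) : 'cV[R]_n := (J z - J x) *m h.
have g_der : has_derivative_on X g Dg.
  move=> z Xz e e0; have := f_der z Xz e e0; rewrite !nearE/=.
  apply: (@filterS _ (nbhs z)) => w h Xw.
  rewrite (_ : _ - _ - _ = f w - f z - J z *m (w - z)) ?h//.
  rewrite /g /Dg mulmxBl !mulmxBr; apply/matrixP => i j; rewrite !mxE; ring.
have DgZ z c h : Dg z (c *: h) = c *: Dg z h by rewrite /Dg scalemxAr.
have -> : f y - f x - J x *m (y - x) = g y - g x.
  by rewrite /g mulmxBr; apply/matrixP => i j; rewrite !mxE; ring.
apply: (ler_fnorm_segment X_convex g_der DgZ Xx Xy) => t t01.
have Xc := convex_set_segment X_convex Xx Xy t01.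
rewrite /Dg (le_trans (ler_opnorm (mulmx (J (x + t *: (y - x)) - J x)) _))//.
rewrite (le_trans (ler_wpM2r (fnorm_ge0 _) (J_lip _ _ Xc Xx)))//.
rewrite expr2 mulrA ler_wpM2r ?fnorm_ge0// ler_wpM2l//.
rewrite addrAC subrr add0r fnormZ ler_piMl ?fnorm_ge0// ger0_norm.
  by case/andP: t01.
by case/andP: t01.
Qed.

Hypotheses (J_der : has_derivative_on X J (fun x h => H x h))
  (H_bounded : forall x, X x -> opnorm (fun h => H x h) <= L).

Lemma ler_fnorm_hessian x h : X x -> fnorm (H x h) <= L * fnorm h.
Proof.
move=> Xx; rewrite (le_trans (ler_opnorm (H x) h))//.
by rewrite ler_wpM2r ?fnorm_ge0//; exact: H_bounded.
Qed.

(** The Frobenius-norm version, in which the tracker error is measured: the bound on the Hessian,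
    whose values carry the Frobenius norm, is integrated along the segment. *)
Lemma jacobian_lipschitz x y : X x -> X y -> fnorm (J y - J x) <= L * fnorm (y - x).
Proof.
move=> Xx Xy; have HZ z (c : R) h : H z (c *: h) = c *: H z h by rewrite linearZ.
apply: (ler_fnorm_segment X_convex J_der HZ Xx Xy) => t t01.
exact: ler_fnorm_hessian (convex_set_segment X_convex Xx Xy t01).
Qed.

Hypothesis H_cont : forall x, X x -> forall e : R, 0 < e ->
  \forall y \near within X (nbhs x), opnorm (fun h => H y h - H x h) <= e.

Lemma hessian_continuous h x (e : R) : X x -> 0 < e ->
  \forall y \near within X (nbhs x), fnorm (H y h - H x h) <= e.
Proof.
move=> Xx e0; have k0 : 0 < e / (fnorm h + 1).
  by rewrite divr_gt0// ltr_wpDl// fnorm_ge0.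
have := H_cont Xx k0; rewrite !nearE/=.
apply: (@filterS _ (nbhs x)) => y hy Xy.
rewrite (le_trans (ler_opnorm (H y \- H x) h))//.
rewrite (le_trans (ler_wpM2r (fnorm_ge0 _) (hy Xy)))//.
rewrite mulrAC ler_pdivrMr ?ltr_wpDl ?fnorm_ge0// mulrDr mulr1 lerDl ltW//.
Qed.

End Smoothness.

Lemma continuous_of_lipschitz (R : realType) d m p (X : set 'cV[R]_d)
   (g : 'cV[R]_d -> 'M[R]_(m, p)) (L : R) : 0 <= L ->
  (forall x y, X x -> X y -> fnorm (g y - g x) <= L * fnorm (y - x)) ->
  forall x, X x -> forall e : R, 0 < e ->
     \forall y \near within X (nbhs x), fnorm (g y - g x) <= e.
Proof.
move=> L0 gL x Xx e e0; rewrite nearE/=.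
pose k : R := L * (d * 1)%:R + 1.
have k0 : 0 < k by rewrite ltr_wpDl// mulr_ge0.
apply/nbhs_ballP; exists (e / k) => /=; first by rewrite divr_gt0.
move=> y; rewrite -ball_normE /= => /ltW; rewrite ler_pdivlMr// => xy Xy.
rewrite (le_trans (gL _ _ Xx Xy))// (le_trans _ xy)//.
rewrite (le_trans (ler_wpM2l L0 (ler_fnorm_mx_norm _)))// mulrA.
by rewrite distrC mulrC ler_wpM2l// lerDl ler01.
Qed.

Section Descent.
Context {R : realType} {d n : nat}.
Variables (X : set 'cV[R]_d) (F : 'cV[R]_n -> 'cV[R]_d -> R)
  (f : 'cV[R]_d -> 'cV[R]_n) (J : 'cV[R]_d -> 'M[R]_(n, d)) (LF L D : R).
Hypotheses (X_convex : convex_set X) (LF_ge0 : 0 <= LF) (L_ge0 : 0 <= L)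
  (D_ge0 : 0 <= D)
  (X_diam : forall x y, X x -> X y -> fnorm (x - y) <= D)
  (F_lipschitz : forall (x : 'cV[R]_d) (u1 u2 : 'cV[R]_n), X x ->
     `|F u1 x - F u2 x| <= LF * fnorm (u1 - u2))
  (F_convex : convex_function ([set: 'cV[R]_n] `*` X)
     (fun q : 'cV[R]_n * 'cV[R]_d => F q.1 q.2))
  (gap_min : forall y, X y ->
     exists x, is_argmin X (fun x => F (f y + J y *m (x - y)) x) x)
  (f_taylor : forall x y, X x -> X y ->
     fnorm (f y - f x - J x *m (y - x)) <= L * fnorm (y - x) ^+ 2).

Lemma fw_gap_argmin y x : X y -> is_argmin X (fun x => F (f y + J y *m (x - y)) x) x ->
  fw_gap X F f J y = F (f y) y - F (f y + J y *m (x - y)) x.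
Proof.
move=> Xy [Xx xmin]; rewrite /fw_gap; congr (_ - _).
apply/eqP; rewrite eq_le; apply/andP; split.
  apply: inf_lbound; last by exists x.
  by exists (F (f y + J y *m (x - y)) x) => _ [w Xw <-]; exact: xmin.
by apply: lb_le_inf; [exists (F (f y + J y *m (x - y)) x), x|move=> _ [w Xw <-]; exact: xmin].
Qed.

(** The point [y] itself competes in the minimum, with value F (f y) y. *)
Lemma fw_gap_ge0 y : X y -> 0 <= fw_gap X F f J y.
Proof.
move=> Xy; have [x xmin] := gap_min Xy; rewrite (fw_gap_argmin Xy xmin) subr_ge0.
by have [_ /(_ _ Xy)] := xmin; rewrite subrr mulmx0 addr0.
Qed.

(** The tracked and the exact linear models differ by at most [LF * E] anywhere on [X], so the
    minimizer of the first is within twice that of the minimum of the second. The last term is the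
    Taylor remainder passed through [F]. *)
Lemma fw_gap_descent (gamma : R) y z V x y' : 0 <= gamma <= 1 -> X y ->
  is_argmin X (fun x' => F (z + V *m (x' - y)) x') x ->
  y' = (1 - gamma) *: y + gamma *: x ->
  gamma * fw_gap X F f J y <=
    F (f y) y - F (f y') y' +
    gamma * (2 * LF * (fnorm (z - f y) + D * fnorm (V - J y)))
    + LF * L * D ^+ 2 * gamma ^+ 2.
Proof.
move=> g01 Xy [Xx xmin] y'E; have /andP[g0 g1] := g01.
have Xy' : X y' by rewrite y'E; exact: convex_set_comb.
have [xs xsmin] := gap_min Xy; have [Xs _] := xsmin.
rewrite (fw_gap_argmin Xy xsmin).
set E := fnorm (z - f y) + _.
have lin w : X w -> `|F (z + V *m (w - y)) w - F (f y + J y *m (w - y)) w| <= LF * E.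
  move=> Xw; rewrite (le_trans (F_lipschitz _ _ Xw))// ler_wpM2l//.
  have -> : z + V *m (w - y) - (f y + J y *m (w - y)) = (z - f y) + (V - J y) *m (w - y).
    by rewrite mulmxBl opprD addrACA.
  rewrite (le_trans (ler_fnormD _ _))// lerD2l (le_trans (ler_fnorm_mul _ _))//.
  by rewrite mulrC ler_wpM2r ?fnorm_ge0 ?X_diam.
have hx : F (f y + J y *m (x - y)) x <= F (f y + J y *m (xs - y)) xs + 2 * LF * E.
  have := lin _ Xx; have := lin _ Xs; rewrite !ler_norml => /andP[a1 a2] /andP[b1 b2].
  by have := xmin _ Xs; lra.
have yy : y' - y = gamma *: (x - y).
  by rewrite y'E scalerBl scale1r scalerBr addrAC addrAC -addrA addrC addrA subrK addrC.
have h1 : F (f y') y' <= F (f y + J y *m (y' - y)) y' + LF * (L * D ^+ 2 * gamma ^+ 2).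
  have := F_lipschitz (f y') (f y + J y *m (y' - y)) Xy'.
  rewrite opprD addrA => h; rewrite addrC -lerBlDr (le_trans (ler_norm _))//.
  rewrite (le_trans h)// ler_wpM2l// (le_trans (f_taylor Xy Xy'))// -mulrA ler_wpM2l//.
  rewrite yy fnormZ exprMn mulrC ger0_norm// ler_wpM2r ?sqr_ge0//.
  by rewrite ler_pXn2r ?nnegrE ?fnorm_ge0// X_diam.
(* Joint convexity is applied to the pairs (f y + J y (x - y), x) and (f y, y): the linear model is
   affine, so their combination is the model at [y'] paired with [y']. *)
have h2 : F (f y + J y *m (y' - y)) y' <=
    gamma * F (f y + J y *m (x - y)) x + (1 - gamma) * F (f y) y.
  have := @F_convex (Itv01 g0 g1) (f y + J y *m (x - y), x) (f y, y) _ _.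
  rewrite !inE => /(_ (conj I Xx) (conj I Xy)).
  congr (_ <= _); rewrite /=.
  have -> : y' = gamma *: x + (1 - gamma) *: y by rewrite y'E addrC.
  congr (F _ _).
  have -> : gamma *: x + (1 - gamma) *: y - y = gamma *: (x - y).
    by rewrite -yy y'E (addrC ((1 - gamma) *: y)).
  rewrite -scalemxAr; move: (J y *m _) => v.
  by apply/matrixP => i j; rewrite !mxE /unstable.onem; ring.
rewrite mulrBr; have := ler_wpM2l g0 hx; rewrite mulrDr.
lra.
Qed.

End Descent.

(** * The filtration of the draws *)

Section Draws.
Context {R : realType} {dO dXi : measure_display} {Omega : measurableType dO}
  {Xi : measurableType dXi} {P : probability Omega R} {D : probability Xi R}.
Variables (xi zeta : nat -> {RV P >-> Xi}) (alpha : nat -> {RV P >-> R}).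
Hypothesis samp : sampling D xi zeta alpha.

Definition drawn (S : set (nat + nat + nat)) : set (set Omega) :=
  \bigcup_(s in S) draw_events xi zeta alpha s.

(* [Omega] with the sigma-algebra generated by the draws indexed by [S]. *)
Definition after (S : set (nat + nat + nat)) := g_sigma_algebraType (drawn S).

Lemma draw_events_measurable s : draw_events xi zeta alpha s `<=` measurable.
Proof.
by case: s => [[k|k]|k] _ [B mB <-] /=; rewrite setTI;
  rewrite -[X in measurable X]setTI; apply: measurable_funP.
Qed.

Lemma draw_events_setI s : setI_closed (draw_events xi zeta alpha s).
Proof.
case: s => [[k|k]|k] _ _ [B mB <-] [C mC <-] /=; exists (B `&` C);
  by [exact: measurableI|rewrite !setTI preimage_setI].
Qed.

Lemma draw_events_setT s : draw_events xi zeta alpha s setT.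
Proof. by case: s => [[k|k]|k] /=; exists setT => //; rewrite setTI. Qed.

Lemma after_measurable S : (measurable : set (set (after S))) `<=` (measurable : set (set Omega)).
Proof.
apply: smallest_sub; first exact: sigma_algebra_measurable.
by move=> A [s _]; exact: draw_events_measurable.
Qed.

Lemma after_subset S S' : S `<=` S' ->
  (measurable : set (set (after S))) `<=` (measurable : set (set (after S'))).
Proof.
move=> SS'; apply: smallest_sub; first exact: smallest_sigma_algebra.
by move=> A [s Ss As]; apply: sub_sigma_algebra; exists s => //; exact: SS'.
Qed.

Lemma after_mx_subset S S' m p (A : Omega -> 'M[R]_(m, p)) : S `<=` S' ->
  mx_measurable (setT : set (after S)) A -> mx_measurable (setT : set (after S')) A.
Proof.
move=> SS' mA i j _ Y mY; apply: (after_subset SS'); exact: mA.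
Qed.

Lemma after_mx_measurable S m p (A : Omega -> 'M[R]_(m, p)) :
  mx_measurable (setT : set (after S)) A -> mx_measurable (setT : set Omega) A.
Proof. by move=> mA i j _ Y mY; apply: (@after_measurable S); exact: mA. Qed.

Lemma measurable_xi S k : S (inl (inl k)) -> measurable_fun (setT : set (after S)) (xi k).
Proof. by move=> Sk _ Y mY; apply: sub_sigma_algebra; exists (inl (inl k)) => //; exists Y. Qed.

Lemma measurable_zeta S k : S (inl (inr k)) ->
  measurable_fun (setT : set (after S)) (zeta k.+1).
Proof. by move=> Sk _ Y mY; apply: sub_sigma_algebra; exists (inl (inr k)) => //; exists Y. Qed.

Lemma measurable_alpha S k : S (inr k) ->
  measurable_fun (setT : set (after S)) (alpha k.+1).
Proof. by move=> Sk _ Y mY; apply: sub_sigma_algebra; exists (inr k) => //; exists Y. Qed.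

(** The past enters as the identity map from the sample space to [after S], whose preimages are
    exactly the events generated by the draws in [S]; [t] lies outside [S], so [u] is independent of
    it. *)
Lemma draw_step (S : set (nat + nat + nat)) t dT (T : measurableType dT)
    (mu : probability T R) (u : {RV P >-> T}) m p (r c : R)
    (e : Omega -> 'M[R]_(m, p)) (g : Omega -> T -> 'M[R]_(m, p)) :
  ~ S t ->
  (forall B, measurable B -> draw_events xi zeta alpha t (u @^-1` B)) ->
  (forall B, measurable B -> P (u @^-1` B) = mu B) ->
  1 < r <= 2 ->
  mx_measurable (setT : set (after S)) e ->
  mx_measurable (setT : set (after S * T)) (fun q => g q.1 q.2) ->
  (forall w, is_mean mu (g w) 0) ->
  (forall w, \int[mu]_t (fnorm (g w t) `^ r)%:E <= c%:E)%E ->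
  (\int[P]_w (fnorm (e w + g w (u w)) `^ r)%:E <=
   \int[P]_w (fnorm (e w) `^ r)%:E + (6 * c)%:E)%E.
Proof.
move=> St Eu lawu r12 me mg g0 gc.
have mid : measurable_fun (setT : set Omega) (id : Omega -> after S).
  by move=> _ Y mY; rewrite setTI; exact: (@after_measurable S).
pose phi : {mfun Omega >-> after S} := HB.pack (id : Omega -> after S)
  (isMeasurableFun.Build _ _ _ _ _ mid).
apply: (@powR_fnorm_martingale_step _ _ _ _ (after S) T R P mu phi u m p r c e g) => //.
move=> A B mA mB; rewrite -lawu//.
have [_ _ _ _ indep] := samp.
apply: (indep_generated indep) St _ _ => //.
- exact: draw_events_measurable.
- exact: draw_events_setI.
- exact: draw_events_setT.
- exact: Eu.
Qed.

Lemma xi_step (S : set (nat + nat + nat)) k m p (r c : R)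
    (e : Omega -> 'M[R]_(m, p)) (g : Omega -> Xi -> 'M[R]_(m, p)) :
  ~ S (inl (inl k)) -> 1 < r <= 2 ->
  mx_measurable (setT : set (after S)) e ->
  mx_measurable (setT : set (after S * Xi)) (fun q => g q.1 q.2) ->
  (forall w, is_mean D (g w) 0) ->
  (forall w, \int[D]_t (fnorm (g w t) `^ r)%:E <= c%:E)%E ->
  (\int[P]_w (fnorm (e w + g w (xi k w)) `^ r)%:E <=
   \int[P]_w (fnorm (e w) `^ r)%:E + (6 * c)%:E)%E.
Proof.
move=> Sk; have [lawx _ _ _ _] := samp.
apply: (draw_step (t := inl (inl k))) => // B mB; last exact: lawx.
by exists B => //; rewrite setTI.
Qed.

Lemma zeta_step (S : set (nat + nat + nat)) k m p (r c : R)
    (e : Omega -> 'M[R]_(m, p)) (g : Omega -> Xi -> 'M[R]_(m, p)) :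
  ~ S (inl (inr k)) -> 1 < r <= 2 ->
  mx_measurable (setT : set (after S)) e ->
  mx_measurable (setT : set (after S * Xi)) (fun q => g q.1 q.2) ->
  (forall w, is_mean D (g w) 0) ->
  (forall w, \int[D]_t (fnorm (g w t) `^ r)%:E <= c%:E)%E ->
  (\int[P]_w (fnorm (e w + g w (zeta k.+1 w)) `^ r)%:E <=
   \int[P]_w (fnorm (e w) `^ r)%:E + (6 * c)%:E)%E.
Proof.
move=> Sk; have [_ lawz _ _ _] := samp.
apply: (draw_step (t := inl (inr k))) => // B mB; last exact: lawz.
by exists B => //; rewrite setTI.
Qed.

Lemma alpha_step (S : set (nat + nat + nat)) k m p (r c : R)
    (e : Omega -> 'M[R]_(m, p)) (g : Omega -> R -> 'M[R]_(m, p)) :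
  ~ S (inr k) -> 1 < r <= 2 ->
  mx_measurable (setT : set (after S)) e ->
  mx_measurable (setT : set (after S * R)) (fun q => g q.1 q.2) ->
  (forall w, is_mean (uniform_prob (@ltr01 R)) (g w) 0) ->
  (forall w, \int[uniform_prob (@ltr01 R)]_t (fnorm (g w t) `^ r)%:E <= c%:E)%E ->
  (\int[P]_w (fnorm (e w + g w (alpha k.+1 w)) `^ r)%:E <=
   \int[P]_w (fnorm (e w) `^ r)%:E + (6 * c)%:E)%E.
Proof.
move=> Sk r12 me mg g0 gc; have [_ _ lawa _ _] := samp.
have ma : measurable_fun setT (alpha k.+1 : Omega -> measurableTypeR R).
  have h : measurable_fun setT (alpha k.+1) by exact: measurable_funP.
  by move=> _ B mB; exact: (h measurableT B mB).
pose u : {RV P >-> measurableTypeR R} :=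
  HB.pack (alpha k.+1 : Omega -> measurableTypeR R) (isMeasurableFun.Build _ _ _ _ _ ma).
apply: (@draw_step S (inr k) _ _ (uniform_prob (@ltr01 R)) u m p r c e g) => // B mB.
  by exists B => //; rewrite setTI.
exact: lawa.
Qed.

End Draws.

Lemma sum_geometric_le (R : realType) (th s : R) n : 0 < s -> 0 <= th -> th <= 1 - s ->
  \sum_(k < n) th ^+ k <= s^-1.
Proof.
move=> s0 th0 ths; have th1 : 0 < 1 - th by lra.
rewrite -[leRHS]mul1r ler_pdivlMr//.
have -> : 1 = (1 - th ^+ n) + th ^+ n :> R by rewrite subrK.
have := subrX1 th n; rewrite -opprB => /(congr1 -%R); rewrite opprK -mulNr opprB => ->.
have S0 : 0 <= \sum_(i < n) th ^+ i by apply: sumr_ge0 => i _; exact: exprn_ge0.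
rewrite (@le_trans _ _ ((1 - th) * \sum_(i < n) th ^+ i))//.
  by rewrite mulrC ler_wpM2r//; lra.
by rewrite lerDl exprn_ge0.
Qed.

(** * Moment recursions *)

Section MomentRecursion.
Context {d : measure_display} {T : measurableType d} {R : realType}
  {P : probability T R} {m p : nat}.
Variables (e : nat -> T -> 'M[R]_(m, p)) (r s B0 B1 : R).
Hypotheses (r12 : 1 < r <= 2) (s01 : 0 < s <= 1) (B0_ge0 : 0 <= B0) (B1_ge0 : 0 <= B1)
  (me : forall k, mx_measurable setT (e k))
  (e0 : (\int[P]_w (fnorm (e 0%N w) `^ r)%:E <= B0%:E)%E)
  (eS : forall k, (\int[P]_w (fnorm (e k.+1 w) `^ r)%:E <=
     (1 - s)%:E * \int[P]_w (fnorm (e k w) `^ r)%:E + (s `^ r * B1)%:E)%E).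

Lemma moment_recursion k :
  (\int[P]_w (fnorm (e k w) `^ r)%:E <= ((1 - s) ^+ k * B0 + s `^ (r - 1) * B1)%:E)%E.
Proof.
have /andP[s0 s1] := s01; have /andP[r1 r2] := r12.
elim: k => [|k ih].
  by rewrite (le_trans e0)// lee_fin expr0 mul1r lerDl mulr_ge0 ?powR_ge0.
rewrite (le_trans (eS k))//.
have s1' : (0 <= (1 - s)%:E)%E by rewrite lee_fin subr_ge0.
rewrite (le_trans (leeD2r _ (lee_wpmul2l s1' ih)))// -EFinM -EFinD lee_fin.
have <- : s * s `^ (r - 1) = s `^ r by rewrite mulr_powRB1 ?ltW//; lra.
rewrite exprS; lra.
Qed.

Let th := (1 - s) `^ r^-1.
Let b := s `^ ((r - 1) / r).

(** [th ^+ k] and [b] are the r-th roots of the two terms of the moment bound, which is thus at most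
    (B0 + B1) la^r for their sum [la]. Then [ler_addM_powR] at scale [la] costs the additional 1. *)
Lemma mean_fnorm_recursion k :
  (\int[P]_w (fnorm (e k w))%:E <= ((1 + B0 + B1) * (th ^+ k + b))%:E)%E.
Proof.
have /andP[s0 s1] := s01; have /andP[r1 r2] := r12; have r0 : 0 < r by lra.
have th0 : 0 <= th ^+ k by rewrite exprn_ge0 ?powR_ge0.
have b0 : 0 < b by rewrite powR_gt0.
set la := th ^+ k + b; have la0 : 0 < la by rewrite ltr_wpDl.
have thr : (th ^+ k) `^ r = (1 - s) ^+ k.
  rewrite /th -!powR_mulrn ?powR_ge0 ?subr_ge0// -!powRrM mulrCA.
  by rewrite mulVf ?mulr1// gt_eqF.
have br : b `^ r = s `^ (r - 1) by rewrite /b -powRrM divfK// gt_eqF.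
have U := moment_recursion k.
have {}U : (\int[P]_w (fnorm (e k w) `^ r)%:E <= ((B0 + B1) * la `^ r)%:E)%E.
  rewrite (le_trans U)// lee_fin -thr -br mulrDl; apply: lerD.
    rewrite mulrC ler_wpM2l// ge0_ler_powR ?nnegrE ?(ltW r0) ?(ltW la0)// lerDl ltW//.
  by rewrite mulrC ler_wpM2l// ge0_ler_powR ?nnegrE ?(ltW r0) ?(ltW la0) ?(ltW b0)// lerDr.
have mr := measurable_powR_fnorm r (me k).
have c0 : (0 <= (la `^ (1 - r))%:E :> \bar R)%E by rewrite lee_fin powR_ge0.
apply: (@le_trans _ _ (\int[P]_w (la%:E + (la `^ (1 - r))%:E * (fnorm (e k w) `^ r)%:E))%E).
  apply: ge0_le_integral => //.
  - by move=> w _; rewrite lee_fin fnorm_ge0.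
  - by apply/measurable_EFinP; exact: measurable_fnorm.
  - apply: emeasurable_funD; first exact: measurable_cst.
    exact: measurable_funeM.
  - move=> w _; rewrite -EFinM -EFinD lee_fin ler_addM_powR ?fnorm_ge0//; exact: ltW.
rewrite ge0_integralD//; last 3 first.
- by move=> w _; rewrite lee_fin ltW.
- by move=> w _; rewrite mule_ge0// lee_fin powR_ge0.
- exact: measurable_funeM.
rewrite integral_cst//= probability_setT mule1 ge0_integralZl//; last first.
  by move=> w _; rewrite lee_fin powR_ge0.
rewrite (le_trans (leeD2l _ (lee_wpmul2l c0 U)))// -EFinM -EFinD lee_fin.
rewrite mulrCA -powRD ?(gt_eqF la0) ?implybT//.
have -> : 1 - r + r = 1 by rewrite subrK.
rewrite powRr1 ?(ltW la0)//; lra.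
Qed.

(** The tangent bound gives th <= 1 - s/r <= 1 - s/2 since r <= 2, so the geometric part sums to at
    most 2/s. *)
Lemma sum_mean_fnorm_recursion K :
  (\sum_(k < K) \int[P]_w (fnorm (e k w))%:E <=
   ((1 + B0 + B1) * (2 / s + K%:R * b))%:E)%E.
Proof.
have /andP[s0 s1] := s01; have /andP[r1 r2] := r12; have r0 : 0 < r by lra.
rewrite (le_trans (lee_sum _ (fun (k : 'I_K) _ => mean_fnorm_recursion k)))//.
rewrite sumEFin lee_fin -mulr_sumr ler_wpM2l ?addr_ge0 ?ler01//.
rewrite big_split/= sumr_const card_ord -(mulr_natl b) lerD2r.
have -> : 2 / s = (s / 2)^-1 by rewrite invf_div.
apply: sum_geometric_le; rewrite ?divr_gt0 ?powR_ge0//.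
rewrite (le_trans (ler_powR_tangent _ _)) ?subr_ge0//.
  by rewrite invr_gt0 r0 invf_le1// ltW.
have : 2^-1 * s <= r^-1 * s by rewrite ler_wpM2r ?(ltW s0)// lef_pV2 ?posrE.
lra.
Qed.

End MomentRecursion.

(** * Runs of the algorithm *)

Section Composition.
Context {R : realType} {d : nat} {X : set 'cV[R]_d}.
Hypothesis mX : measurable (X : set (borel_cV R d)).
Context {dT : measure_display} {T : measurableType dT} {h : T -> 'cV[R]_d}.
Hypotheses (Xh : forall t, X (h t)) (mh : mx_measurable setT h).

Lemma mx_measurable_comp_borel m p (g : 'cV[R]_d -> 'M[R]_(m, p)) :
  mx_measurable (X : set (borel_cV R d)) g -> mx_measurable setT (fun t => g (h t)).
Proof.
move=> mg i j.
apply: (@measurable_comp _ _ _ _ _ _ (X : set (borel_cV R d)) (fun x => g x i j)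
  setT (h : T -> borel_cV R d)) => //; last exact: measurable_borel_cV.
by move=> _ [t _ <-]; exact: Xh.
Qed.

Context {dXi : measure_display} {Xi : measurableType dXi} {s : T -> Xi}.
Hypothesis ms : measurable_fun setT s.

Lemma jointly_measurable_comp m p (g : 'cV[R]_d -> Xi -> 'M[R]_(m, p)) :
  jointly_measurable X g -> mx_measurable setT (fun t => g (h t) (s t)).
Proof.
move=> mg i j.
apply: (@measurable_comp _ _ _ _ _ _ ((X : set (borel_cV R d)) `*` [set: Xi])
  (fun q : borel_cV R d * Xi => g q.1 q.2 i j)
  setT (fun t => (h t : borel_cV R d, s t))) => //.
- exact: measurableX.
- by move=> _ [t _ <-]; split => //=; exact: Xh.
- by apply: measurable_fun_pair => //; exact: measurable_borel_cV.
Qed.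

(** The Hessian is jointly measurable for each fixed direction only; a random direction is expanded
    in the basis, with its coordinates as measurable coefficients. *)
Lemma jointly_measurable_linear m p
    (g : 'cV[R]_d -> Xi -> {linear 'cV[R]_d -> 'M[R]_(m, p)}) (v : T -> 'cV[R]_d) :
  (forall u, jointly_measurable X (fun x s => g x s u)) -> mx_measurable setT v ->
  mx_measurable setT (fun t => g (h t) (s t) (v t)).
Proof.
move=> mg mv i j; under eq_fun do rewrite linear_sum_delta summxE.
apply: measurable_sum => k; under eq_fun do rewrite mxE.
apply: measurable_funM; first exact: mv.
exact: (jointly_measurable_comp (mg (delta_mx k 0))).
Qed.

End Composition.

Lemma linear_mx_measurable_comp (R : realType) d (X : set 'cV[R]_d) dT
    (T : measurableType dT) (h v : T -> 'cV[R]_d) m p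
    (g : 'cV[R]_d -> {linear 'cV[R]_d -> 'M[R]_(m, p)}) :
  measurable (X : set (borel_cV R d)) ->
  (forall t, X (h t)) -> mx_measurable setT h -> mx_measurable setT v ->
  (forall u, mx_measurable (X : set (borel_cV R d)) (fun x => g x u)) ->
  mx_measurable setT (fun t => g (h t) (v t)).
Proof.
move=> mX Xh mh mv mg i j; under eq_fun do rewrite linear_sum_delta summxE.
apply: measurable_sum => k; under eq_fun do rewrite mxE.
apply: measurable_funM; first exact: mv.
exact: (mx_measurable_comp_borel mX Xh mh (mg (delta_mx k 0))).
Qed.

Lemma mx_measurable_fst (R : realType) d1 d2 (T1 : measurableType d1)
    (T2 : measurableType d2) m p (A : T1 -> 'M[R]_(m, p)) :
  mx_measurable setT A -> mx_measurable (setT : set (T1 * T2)) (fun q => A q.1).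
Proof. by move=> mA i j; apply: (measurableT_comp (mA i j)). Qed.

Section Run.
Context {R : realType} {d n : nat}.
Variables (X : set 'cV[R]_d) (F : 'cV[R]_n -> 'cV[R]_d -> R)
  (f : 'cV[R]_d -> 'cV[R]_n) (J : 'cV[R]_d -> 'M[R]_(n, d))
  (H : 'cV[R]_d -> {linear 'cV[R]_d -> 'M[R]_(n, d)}).
Context {dXi : measure_display} {Xi : measurableType dXi} {D : probability Xi R}.
Variables (ft : 'cV[R]_d -> Xi -> 'cV[R]_n) (Jt : 'cV[R]_d -> Xi -> 'M[R]_(n, d))
  (Ht : 'cV[R]_d -> Xi -> {linear 'cV[R]_d -> 'M[R]_(n, d)})
  (L DX r sigma_f sigma_g sigma_H : R) (y0 : 'cV[R]_d).
Hypotheses (X_convex : convex_set X) (X_compact : compact X)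
  (X_diam : forall x y, X x -> X y -> fnorm (x - y) <= DX) (DX_gt0 : 0 < DX)
  (L_ge0 : 0 <= L)
  (f_taylor : forall x y, X x -> X y ->
     fnorm (f y - f x - J x *m (y - x)) <= L * fnorm (y - x) ^+ 2)
  (J_der : has_derivative_on X J (fun x h => H x h))
  (H_bounded : forall x, X x -> opnorm (fun h => H x h) <= L)
  (H_cont : forall x, X x -> forall e : R, 0 < e ->
     \forall y \near within X (nbhs x), opnorm (fun h => H y h - H x h) <= e)
  (r12 : 1 < r <= 2)
  (ft_meas : jointly_measurable X ft) (Jt_meas : jointly_measurable X Jt)
  (ft_mean : forall x, X x -> is_mean D (ft x) (f x))
  (Jt_mean : forall x, X x -> is_mean D (Jt x) (J x))
  (ft_moment : forall x, X x ->
     ('E_D[fun s => (fnorm (ft x s - f x) `^ r)%R] <= (sigma_f `^ r)%:E)%E)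
  (Jt_moment : forall x, X x ->
     ('E_D[fun s => (fnorm (Jt x s - J x) `^ r)%R] <= (sigma_g `^ r)%:E)%E)
  (Ht_meas : forall h, jointly_measurable X (fun x s => Ht x s h))
  (Ht_mean : forall x h, X x -> is_mean D (fun s => Ht x s h) (H x h))
  (Ht_moment : forall x, X x ->
     ('E_D[fun s => (opnorm (fun h => Ht x s h - H x h) `^ r)%R]
        <= (sigma_H `^ r)%:E)%E)
  (y0_in : X y0).
Context {dO : measure_display} {Omega : measurableType dO} {P : probability Omega R}.
Variables (xi zeta : nat -> {RV P >-> Xi}) (alpha : nat -> {RV P >-> R})
  (x y : nat -> Omega -> 'cV[R]_d) (z : nat -> Omega -> 'cV[R]_n)
  (V : nat -> Omega -> 'M[R]_(n, d)) (step : R).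
Hypotheses (samp : sampling D xi zeta alpha)
  (run : hessian_sfw_run X F ft Jt Ht y0 step step step xi zeta alpha x y z V)
  (step01 : 0 < step <= 1).

Let mX : measurable (X : set (borel_cV R d)).
Proof. exact: measurable_compact_borel_cV. Qed.

Let mJ : mx_measurable (X : set (borel_cV R d)) J.
Proof.
apply: continuous_within_mx_measurable; apply: (continuous_of_lipschitz L_ge0).
by move=> u v Xu Xv; exact: (jacobian_lipschitz X_convex J_der H_bounded).
Qed.

Let mH h : mx_measurable (X : set (borel_cV R d)) (fun x => H x h).
Proof.
apply: continuous_within_mx_measurable => u Xu e e0.
exact: (hessian_continuous H_cont).
Qed.

(** * Adaptedness of the iterates and of the trackers *)

Definition past k : set (nat + nat + nat) := [set s | (draw_time s <= k)%N].

Lemma run_iterate_in k w : X (y k w).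
Proof.
case: run => [/(_ w)[y0E _ _] _ argm _]; elim: k => [|k ih]; first by rewrite y0E.
have [[Xx _] ->] := argm k w; apply: convex_set_comb => //.
by case/andP: step01 => /ltW -> ->.
Qed.

Lemma run_increment k w : y k.+1 w - y k w = step *: (x k.+1 w - y k w).
Proof.
case: run => [_ _ /(_ k w)[_ ->] _].
rewrite scalerBl scale1r scalerBr; apply/matrixP => i j; rewrite !mxE; ring.
Qed.

Lemma run_increment_le k w : fnorm (y k.+1 w - y k w) <= step * DX.
Proof.
rewrite run_increment fnormZ ger0_norm; last by case/andP: step01 => /ltW.
rewrite ler_wpM2l//; first by case/andP: step01 => /ltW.
by apply: X_diam; [case: run => _ _ /(_ k w)[[]]|exact: run_iterate_in].
Qed.

Local Notation after' S := (setT : set (after xi zeta alpha S)).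

(** The index shift matters: [y k.+1] is fixed by the draws up to iteration [k], so the draws of
    iteration [k.+1] are fresh for the points at which the oracle is called. *)
Lemma run_iterate_measurable k :
  mx_measurable (after' (past k)) (y k) /\ mx_measurable (after' (past k)) (y k.+1).
Proof.
case: (run) => [init _ upd mx].
have next j : mx_measurable (after' (past j)) (y j) ->
    mx_measurable (after' (past j)) (y j.+1).
  move=> my; rewrite (_ : y j.+1 = fun w => (1 - step) *: y j w + step *: x j.+1 w).
    apply: mx_measurableD; apply: mx_measurableZ => //.
    move=> i l _ B mB; rewrite setTI (ord1 l); exact: (mx j i B mB).
  by apply/funext => w; have [_ ->] := upd j w.
elim: k => [|k [_ ih]].
  have my0 : mx_measurable (after' (past 0)) (y 0%N).
    rewrite (_ : y 0%N = fun=> y0); first exact: mx_measurable_cst.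
    by apply/funext => w; have [->] := init w.
  by split=> //; exact: next.
have my : mx_measurable (after' (past k.+1)) (y k.+1).
  by apply: after_mx_subset ih => s /= /leq_trans; apply.
by split=> //; exact: next.
Qed.

Lemma run_curvature_in k w :
  X (y k w + clip01 (alpha k.+1 w) *: (y k.+1 w - y k w)).
Proof. by apply: convex_set_segment; rewrite ?clip01_itv//; exact: run_iterate_in. Qed.

Lemma run_alpha k w : clip01 (alpha k.+1 w) = alpha k.+1 w.
Proof.
case: samp => _ _ _ /(_ k w)/andP[a0 a1] _.
by rewrite clip01_id// !ltW.
Qed.

Let hess_pt k w := y k w + clip01 (alpha k.+1 w) *: (y k.+1 w - y k w).

Lemma run_hessian_point_measurable (S : set (nat + nat + nat)) k :
  past k `<=` S -> S (inr k) -> mx_measurable (after' S) (hess_pt k).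
Proof.
move=> kS Sk; have [my my1] := run_iterate_measurable k.
apply: mx_measurableD; first exact: after_mx_subset my.
apply: mx_measurable_scale.
  by apply: (measurableT_comp measurable_clip01); exact: measurable_alpha.
by apply: mx_measurableB; [exact: after_mx_subset my1|exact: after_mx_subset my].
Qed.

Lemma run_tracker_measurable k : mx_measurable (after' (past k)) (V k).
Proof.
case: (run) => [init rec _ _]; elim: k => [|k ih].
  rewrite (_ : V 0%N = fun w => Jt y0 (xi 0%N w)); last first.
    by apply/funext => w; have [] := init w.
  apply: (jointly_measurable_comp mX (h := fun=> y0)) => //.
  exact: measurable_xi.
have sub : past k `<=` past k.+1 by move=> s /= /leq_trans; apply.
have [my my1] := run_iterate_measurable k.
rewrite (_ : V k.+1 = fun w => (1 - step) *: V k w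
    + step *: Jt (y k.+1 w) (xi k.+1 w)
    + (1 - step) *: Ht (hess_pt k w) (zeta k.+1 w) (y k.+1 w - y k w)); last first.
  by apply/funext => w; have [-> _] := rec k w; rewrite /hess_pt run_alpha.
apply: mx_measurableD; last first.
  apply: mx_measurableZ; apply: (jointly_measurable_linear mX) => //.
  - exact: run_curvature_in.
  - exact: (run_hessian_point_measurable sub (leqnn k.+1)).
  - by apply: measurable_zeta; exact: (leqnn k.+1).
  - by apply: mx_measurableB; [exact: after_mx_subset my1|exact: after_mx_subset my].
apply: mx_measurableD; first by apply: mx_measurableZ; exact: after_mx_subset ih.
apply: mx_measurableZ; apply: (jointly_measurable_comp mX) => //.
- exact: run_iterate_in.
- exact: after_mx_subset my1.
- by apply: measurable_xi; exact: (leqnn k.+1).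
Qed.

(** * Error of the Jacobian tracker *)

Definition jacobian_error k w := V k w - J (y k w).

Lemma jacobian_error_measurable k : mx_measurable (after' (past k)) (jacobian_error k).
Proof.
apply: mx_measurableB; first exact: run_tracker_measurable.
apply: (mx_measurable_comp_borel mX) => //; first exact: run_iterate_in.
by have [] := run_iterate_measurable k.
Qed.

Let noise_alpha k w a := (1 - step) *:
  (H (y k w + clip01 a *: (y k.+1 w - y k w)) (y k.+1 w - y k w)
   - (J (y k.+1 w) - J (y k w))).
Let noise_zeta k w s := (1 - step) *:
  (Ht (hess_pt k w) s (y k.+1 w - y k w) - H (hess_pt k w) (y k.+1 w - y k w)).
Let noise_xi k w s := step *: (Jt (y k.+1 w) s - J (y k.+1 w)).

Lemma jacobian_errorS k w : jacobian_error k.+1 w =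
  (1 - step) *: jacobian_error k w + noise_alpha k w (alpha k.+1 w)
  + noise_zeta k w (zeta k.+1 w) + noise_xi k w (xi k.+1 w).
Proof.
case: (run) => [_ rec _ _]; rewrite /jacobian_error; have [-> _] := rec k w.
rewrite /noise_alpha /noise_zeta /noise_xi -/(hess_pt k w) -run_alpha -/(hess_pt k w).
by apply/matrixP => i j; rewrite !mxE; ring.
Qed.

Let sC : 0 <= step /\ `|1 - step| <= 1 /\ 0 <= 1 - step.
Proof.
have /andP[s0 s1] := step01; split; first exact: ltW.
by split; [rewrite ger0_norm|]; lra.
Qed.

Lemma integral_powR_noise_alpha k w :
  (\int[uniform_prob (@ltr01 R)]_a (fnorm (noise_alpha k w a) `^ r)%:E <=
   (step `^ r * (2 * L * DX) `^ r)%:E)%E.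
Proof.
have [s0 [s1 _]] := sC.
rewrite (@le_trans _ _ (\int[uniform_prob (@ltr01 R)]_a
    (cst (step `^ r * (2 * L * DX) `^ r)%:E a)))%E//; last first.
  by rewrite integral_cst//= probability_setT mule1.
apply: ge0_le_integral_nomeas => a; first by rewrite lee_fin powR_ge0.
rewrite lee_fin -powRM ?mulr_ge0 ?(ltW DX_gt0)// ge0_ler_powR ?nnegrE ?fnorm_ge0//.
- by case/andP: r12; lra.
- by rewrite !mulr_ge0 ?(ltW DX_gt0).
rewrite fnormZ (le_trans (ler_wpM2r (fnorm_ge0 _) s1))// mul1r.
rewrite (le_trans (ler_fnormB _ _))//.
have Xc : X (y k w + clip01 a *: (y k.+1 w - y k w)).
  by apply: convex_set_segment; rewrite ?clip01_itv//; exact: run_iterate_in.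
have h1 := ler_fnorm_hessian H_bounded (y k.+1 w - y k w) Xc.
have h2 := jacobian_lipschitz X_convex J_der H_bounded (run_iterate_in k w) (run_iterate_in k.+1 w).
have := ler_wpM2l L_ge0 (run_increment_le k w).
lra.
Qed.

(** The displacement, at most [step * DX], supplies the factor [step]; the noise of the Hessian
    itself is not small. *)
Lemma integral_powR_noise_zeta k w :
  (\int[D]_s (fnorm (noise_zeta k w s) `^ r)%:E <=
   (step `^ r * (DX `^ r * sigma_H `^ r))%:E)%E.
Proof.
have [s0 [s1 _]] := sC; have /andP[step0 _] := step01.
have Xc : X (hess_pt k w) by exact: run_curvature_in.
have hm := Ht_moment Xc; rewrite unlock in hm.
have c0 : 0 < (step * DX) `^ r by rewrite powR_gt0// mulr_gt0.
rewrite mulrA -powRM ?(ltW DX_gt0)// EFinM.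
apply: (le_trans _ (lee_wpmul2l _ hm)); last by rewrite lee_fin ltW.
apply: ge0_le_integralZl_nomeas => //.
- apply: measurable_powR_fnorm; apply: mx_measurableZ.
  exact: is_mean_measurable (is_meanB (H (hess_pt k w) _) (Ht_mean _ Xc)).
- by move=> s; rewrite lee_fin powR_ge0.
- by move=> s; rewrite lee_fin powR_ge0.
move=> s; rewrite -EFinM lee_fin -powRM ?mulr_ge0 ?(ltW DX_gt0) ?opnorm_ge0//.
rewrite ge0_ler_powR ?nnegrE ?fnorm_ge0 ?mulr_ge0 ?(ltW DX_gt0) ?opnorm_ge0//.
  by case/andP: r12; lra.
rewrite fnormZ (le_trans (ler_wpM2r (fnorm_ge0 _) s1))// mul1r mulrC.
rewrite (le_trans (ler_opnorm (Ht (hess_pt k w) s \- H (hess_pt k w)) _))//.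
by rewrite ler_wpM2l ?opnorm_ge0//; exact: run_increment_le.
Qed.

Lemma integral_powR_scaled_noise m p (G : Xi -> 'M[R]_(m, p)) (sigma : R) :
  mx_measurable setT G ->
  (\int[D]_s (fnorm (G s) `^ r)%:E <= (sigma `^ r)%:E)%E ->
  (\int[D]_s (fnorm (step *: G s) `^ r)%:E <= (step `^ r * sigma `^ r)%:E)%E.
Proof.
move=> mG hG; have /andP[step0 _] := step01.
have c0 : 0 < step `^ r by rewrite powR_gt0.
rewrite EFinM; apply: (le_trans _ (lee_wpmul2l _ hG)); last by rewrite lee_fin ltW.
apply: ge0_le_integralZl_nomeas => //.
- by apply: measurable_powR_fnorm; exact: mx_measurableZ.
- by move=> s; rewrite lee_fin powR_ge0.
- by move=> s; rewrite lee_fin powR_ge0.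
by move=> s; rewrite -EFinM lee_fin -powRM ?(ltW step0) ?fnorm_ge0// fnormZ ger0_norm// ltW.
Qed.

(** The 6 is the constant of [powR_fnormD]; the summands bound the r-th moments of the alpha, zeta
    and xi noises divided by step^r. *)
Let B1 : R := 6 * ((2 * L * DX) `^ r + DX `^ r * sigma_H `^ r + sigma_g `^ r).

(** (1 - step)^r <= 1 - step, since r > 1 and the base lies in [0, 1]. *)
Lemma integral_powR_shrink m p (A : Omega -> 'M[R]_(m, p)) :
  mx_measurable setT A ->
  (\int[P]_w (fnorm ((1 - step) *: A w) `^ r)%:E <=
   (1 - step)%:E * \int[P]_w (fnorm (A w) `^ r)%:E)%E.
Proof.
move=> mA; have [s0 [s1 s2]] := sC; have /andP[r1 r2] := r12.
rewrite -ge0_integralZl//; last 2 first.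
- exact: measurable_powR_fnorm.
- by move=> w _; rewrite lee_fin powR_ge0.
apply: ge0_le_integral_nomeas => w; first by rewrite lee_fin powR_ge0.
rewrite -EFinM lee_fin fnormZ powRM ?fnorm_ge0// ler_wpM2r ?powR_ge0//.
rewrite ger0_norm//; move: s2; rewrite le_eqVlt => /predU1P[<-|s2].
  by rewrite powR0// gt_eqF//; lra.
rewrite -[leRHS](powRr1 (ltW s2)) ger_powR ?(ltW r1)// s2/=.
by rewrite (le_trans (ler_norm _) s1).
Qed.

Lemma jacobian_moment_step k :
  (\int[P]_w (fnorm (jacobian_error k.+1 w) `^ r)%:E <=
   (1 - step)%:E * \int[P]_w (fnorm (jacobian_error k w) `^ r)%:E
   + (step `^ r * B1)%:E)%E.
Proof.
have [my my1] := run_iterate_measurable k; have me := @jacobian_error_measurable k.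
(* [inr k] and [inl (inr k)] index alpha and zeta of iteration k+1: [S2] adds the first to the past
   and [S3] adds the second. The draw xi of iteration k+1 belongs to neither. *)
pose S2 := past k `|` [set inr k]; pose S3 := S2 `|` [set inl (inr k)].
have s12 : past k `<=` S2 by left.
have s23 : S2 `<=` S3 by left.
have s13 : past k `<=` S3 by move=> s /s12/s23.
have mh S : past k `<=` S -> mx_measurable (after' S) (fun w => y k.+1 w - y k w).
  by move=> sS; apply: mx_measurableB; [exact: after_mx_subset my1|exact: after_mx_subset my].
have mJy S : past k `<=` S ->
    mx_measurable (after' S) (fun w => J (y k.+1 w)) /\
    mx_measurable (after' S) (fun w => J (y k w)).
  move=> sS; split; apply: (mx_measurable_comp_borel mX) => //.
  - exact: run_iterate_in.
  - exact: after_mx_subset my1.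
  - exact: run_iterate_in.
  - exact: after_mx_subset my.
pose E0 w := (1 - step) *: jacobian_error k w.
pose E1 w := E0 w + noise_alpha k w (alpha k.+1 w).
pose E2 w := E1 w + noise_zeta k w (zeta k.+1 w).
pose E3 w := E2 w + noise_xi k w (xi k.+1 w).
have -> : jacobian_error k.+1 = E3 by apply/funext => w; exact: jacobian_errorS.
have m1 : mx_measurable (after' S2) E1.
  apply: mx_measurableD; first by apply: mx_measurableZ; exact: after_mx_subset me.
  apply: mx_measurableZ; apply: mx_measurableB.
    apply: (linear_mx_measurable_comp mX) => //.
    - exact: run_curvature_in.
    - by apply: run_hessian_point_measurable => //; right.
    - exact: mh.
  by have [? ?] := mJy _ s12; apply: mx_measurableB.
have m2 : mx_measurable (after' S3) E2.
  have mp : mx_measurable (after' S3) (hess_pt k).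
    by apply: run_hessian_point_measurable => //; left; right.
  apply: mx_measurableD; first exact: after_mx_subset m1.
  apply: mx_measurableZ; apply: mx_measurableB.
    apply: (jointly_measurable_linear mX) => //.
    - exact: run_curvature_in.
    - by apply: measurable_zeta; right.
    - exact: mh.
  apply: (linear_mx_measurable_comp mX) => //; last exact: mh.
  exact: run_curvature_in.
have st3 : (\int[P]_w (fnorm (E3 w) `^ r)%:E <=
    \int[P]_w (fnorm (E2 w) `^ r)%:E + (6 * (step `^ r * sigma_g `^ r))%:E)%E.
  apply: (xi_step samp (S := S3) (k := k.+1) (g := noise_xi k)) => //.
  - by move=> [[|]|] //=; rewrite /past/= ltnn.
  - apply: mx_measurableZ; apply: mx_measurableB.
      apply: (jointly_measurable_comp mX) => //.
      + by move=> q; exact: run_iterate_in.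
      + by apply: mx_measurable_fst; exact: after_mx_subset my1.
    by have [mj _] := mJy _ s13; exact: (mx_measurable_fst mj).
  - move=> w; have := is_meanZ step (is_meanB (J (y k.+1 w)) (Jt_mean (run_iterate_in k.+1 w))).
    by rewrite subrr scaler0.
  - move=> w; have Jm := Jt_moment (run_iterate_in k.+1 w); rewrite unlock in Jm.
    apply: (integral_powR_scaled_noise _ Jm).
    exact: is_mean_measurable (is_meanB _ (Jt_mean (run_iterate_in k.+1 w))).
have st2 : (\int[P]_w (fnorm (E2 w) `^ r)%:E <= \int[P]_w (fnorm (E1 w) `^ r)%:E
    + (6 * (step `^ r * (DX `^ r * sigma_H `^ r)))%:E)%E.
  apply: (zeta_step samp (S := S2) (k := k) (g := noise_zeta k)) => //.
  - by move=> [|] //=; rewrite /past/= ltnn.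
  - have mp : mx_measurable (after' S2) (hess_pt k).
      by apply: run_hessian_point_measurable => //; right.
    apply: mx_measurableZ; apply: mx_measurableB.
      apply: (jointly_measurable_linear mX) => //.
      + by move=> q; exact: run_curvature_in.
      + exact: mx_measurable_fst mp.
      + exact: mx_measurable_fst (mh _ s12).
    apply: (linear_mx_measurable_comp mX) => //.
    + by move=> q; exact: run_curvature_in.
    + exact: mx_measurable_fst mp.
    + exact: mx_measurable_fst (mh _ s12).
  - move=> w; have := is_meanZ (1 - step) (is_meanB (H (hess_pt k w) (y k.+1 w - y k w))
      (Ht_mean (y k.+1 w - y k w) (run_curvature_in k w))).
    by rewrite subrr scaler0.
  - exact: integral_powR_noise_zeta.
have st1 : (\int[P]_w (fnorm (E1 w) `^ r)%:E <= \int[P]_w (fnorm (E0 w) `^ r)%:E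
    + (6 * (step `^ r * (2 * L * DX) `^ r))%:E)%E.
  apply: (alpha_step samp (S := past k) (k := k) (g := noise_alpha k)) => //.
  - by rewrite /past/= ltnn.
  - exact: mx_measurableZ me.
  - apply: mx_measurableZ; apply: mx_measurableB.
      apply: (linear_mx_measurable_comp mX) => //.
      + by move=> q; apply: convex_set_segment; rewrite ?clip01_itv//; exact: run_iterate_in.
      + apply: mx_measurableD; first exact: mx_measurable_fst my.
        apply: mx_measurable_scale; first by apply: (measurableT_comp measurable_clip01).
        exact: mx_measurable_fst (mh _ (@subset_refl _ _)).
      + exact: mx_measurable_fst (mh _ (@subset_refl _ _)).
    have [mj1 mj] := mJy _ (@subset_refl _ _).
    by apply: mx_measurableB; [exact: (mx_measurable_fst mj1)|exact: (mx_measurable_fst mj)].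
  - move=> w.
    have HZ u (c : R) h : H u (c *: h) = c *: H u h by rewrite linearZ.
    have := is_mean_segment X_convex J_der HZ (run_iterate_in k w) (run_iterate_in k.+1 w)
      (M := L * fnorm (y k.+1 w - y k w)) _ _.
    move=> /(_ _ _)/(is_meanB (J (y k.+1 w) - J (y k w)))/(is_meanZ (1 - step)).
    rewrite subrr scaler0; apply.
      by move=> u Xu e e0; exact: (hessian_continuous H_cont).
    by move=> u Xu; exact: (ler_fnorm_hessian H_bounded).
  - exact: integral_powR_noise_alpha.
rewrite (le_trans st3)// (le_trans (leeD2r _ st2))// (le_trans (leeD2r _ (leeD2r _ st1)))//.
have sh : (\int[P]_w (fnorm (E0 w) `^ r)%:E <=
    (1 - step)%:E * \int[P]_w (fnorm (jacobian_error k w) `^ r)%:E)%E.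
  exact: integral_powR_shrink (after_mx_measurable me).
rewrite (le_trans (leeD2r _ (leeD2r _ (leeD2r _ sh))))//.
move: (_ * \int[P]_w _)%E => A; rewrite -!addeA leeD2l// -!EFinD lee_fin /B1.
rewrite le_eqVlt; apply/orP; left; apply/eqP; ring.
Qed.

(** The starting point is deterministic, so the initial errors are functions of the first draw alone
    and only its law matters. *)
Lemma integral_powR_xi0 m p (G : Xi -> 'M[R]_(m, p)) (sigma : R) :
  mx_measurable setT G ->
  (\int[D]_s (fnorm (G s) `^ r)%:E <= (sigma `^ r)%:E)%E ->
  (\int[P]_w (fnorm (G (xi 0%N w)) `^ r)%:E <= (sigma `^ r)%:E)%E.
Proof.
move=> mG hG; have mGr := measurable_powR_fnorm r mG.
have mx : measurable_fun setT (xi 0%N) by exact: measurable_funP.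
have g0 : {in [set: Xi], forall s, (0 <= (fnorm (G s) `^ r)%:E)%E}.
  by move=> s _; rewrite lee_fin powR_ge0.
have := ge0_integral_pushforward mx P measurableT mGr g0.
rewrite preimage_setT => <-; rewrite (eq_measure_integral D)// => A mA _.
by have [lawx _ _ _ _] := samp; exact: lawx.
Qed.

Lemma jacobian_error0_moment :
  (\int[P]_w (fnorm (jacobian_error 0 w) `^ r)%:E <= (sigma_g `^ r)%:E)%E.
Proof.
case: (run) => [init _ _ _].
have -> : jacobian_error 0 = (fun w => Jt y0 (xi 0%N w) - J y0).
  by apply/funext => w; rewrite /jacobian_error; have [-> _ ->] := init w.
have Jm := Jt_moment y0_in; rewrite unlock in Jm.
apply: (integral_powR_xi0 (G := fun s => Jt y0 s - J y0) _ Jm).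
exact: is_mean_measurable (is_meanB _ (Jt_mean y0_in)).
Qed.

(** * Error of the function tracker *)

Let mf : mx_measurable (X : set (borel_cV R d)) f.
Proof.
apply: continuous_within_mx_measurable.
(* A Lipschitz constant of [f] on [X]: the first two terms bound the Jacobian there, the third
   absorbs the Taylor remainder. *)
have L'0 : 0 <= fnorm (J y0) + L * DX + L * DX.
  by rewrite !addr_ge0 ?fnorm_ge0 ?mulr_ge0 ?(ltW DX_gt0).
apply: (continuous_of_lipschitz L'0) => u v Xu Xv.
rewrite -(subrK (J u *m (v - u)) (f v - f u)) (le_trans (ler_fnormD _ _))//.
have h1 := f_taylor Xu Xv.
have h2 : fnorm (J u *m (v - u)) <= (fnorm (J y0) + L * DX) * fnorm (v - u).
  rewrite (le_trans (ler_fnorm_mul _ _))// ler_wpM2r ?fnorm_ge0//.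
  rewrite -[J u](subrK (J y0)) addrC (le_trans (ler_fnormD _ _))// lerD2l.
  rewrite (le_trans (jacobian_lipschitz X_convex J_der H_bounded y0_in Xu))//.
  by rewrite ler_wpM2l// X_diam.
have h3 : L * fnorm (v - u) ^+ 2 <= L * DX * fnorm (v - u).
  by rewrite expr2 mulrA ler_wpM2r ?fnorm_ge0// ler_wpM2l// X_diam.
lra.
Qed.

(* The part of the error of [z] caused by the oracle noise in [ft] alone; what
   remains of [z k - f (y k)] is controlled pathwise by the Jacobian errors. *)
Fixpoint value_noise k w : 'cV[R]_n := if k is k'.+1 then
    (1 - step) *: value_noise k' w
    + step *: (ft (y k w) (xi k w) - f (y k w))
  else ft y0 (xi 0%N w) - f y0.

Lemma value_noise_measurable k : mx_measurable (after' (past k)) (value_noise k).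
Proof.
elim: k => [|k ih] /=.
  apply: mx_measurableB; last exact: mx_measurable_cst.
  apply: (jointly_measurable_comp mX (h := fun=> y0)) => //.
  exact: measurable_xi.
have sub : past k `<=` past k.+1 by move=> s /= /leq_trans; apply.
have [my my1] := run_iterate_measurable k.
have my1' := after_mx_subset sub my1.
apply: mx_measurableD; first by apply: mx_measurableZ; exact: after_mx_subset ih.
apply: mx_measurableZ; apply: mx_measurableB.
  apply: (jointly_measurable_comp mX) => //.
  - exact: run_iterate_in.
  - by apply: measurable_xi; exact: (leqnn k.+1).
apply: (mx_measurable_comp_borel mX) => //; exact: run_iterate_in.
Qed.

Lemma value_noise_moment_step k :
  (\int[P]_w (fnorm (value_noise k.+1 w) `^ r)%:E <=
   (1 - step)%:E * \int[P]_w (fnorm (value_noise k w) `^ r)%:E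
   + (step `^ r * (6 * sigma_f `^ r))%:E)%E.
Proof.
have [my my1] := run_iterate_measurable k; have mq := @value_noise_measurable k.
pose noise w s := step *: (ft (y k.+1 w) s - f (y k.+1 w)).
have st : (\int[P]_w (fnorm ((1 - step) *: value_noise k w + noise w (xi k.+1 w)) `^ r)%:E <=
    \int[P]_w (fnorm ((1 - step) *: value_noise k w) `^ r)%:E
    + (6 * (step `^ r * sigma_f `^ r))%:E)%E.
  apply: (xi_step samp (S := past k) (k := k.+1) (g := noise)) => //.
  - by rewrite /past/= ltnn.
  - exact: mx_measurableZ mq.
  - apply: mx_measurableZ; apply: mx_measurableB.
      apply: (jointly_measurable_comp mX) => //.
      + by move=> q; exact: run_iterate_in.
      + exact: mx_measurable_fst my1.
    have mfy : mx_measurable (after' (past k)) (fun w => f (y k.+1 w)).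
      apply: (mx_measurable_comp_borel mX) => //; exact: run_iterate_in.
    exact: (mx_measurable_fst mfy).
  - move=> w; have := is_meanZ step (is_meanB (f (y k.+1 w)) (ft_mean (run_iterate_in k.+1 w))).
    by rewrite subrr scaler0.
  - move=> w; have fm := ft_moment (run_iterate_in k.+1 w); rewrite unlock in fm.
    apply: (integral_powR_scaled_noise _ fm).
    exact: is_mean_measurable (is_meanB _ (ft_mean (run_iterate_in k.+1 w))).
have sh : (\int[P]_w (fnorm ((1 - step) *: value_noise k w) `^ r)%:E <=
    (1 - step)%:E * \int[P]_w (fnorm (value_noise k w) `^ r)%:E)%E.
  exact: integral_powR_shrink (after_mx_measurable mq).
rewrite (le_trans st)// (le_trans (leeD2r _ sh))//.
by rewrite leeD2l// lee_fin mulrCA.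
Qed.

Lemma value_noise0_moment :
  (\int[P]_w (fnorm (value_noise 0 w) `^ r)%:E <= (sigma_f `^ r)%:E)%E.
Proof.
have fm := ft_moment y0_in; rewrite unlock in fm.
apply: (integral_powR_xi0 (G := fun s => ft y0 s - f y0) _ fm).
exact: is_mean_measurable (is_meanB _ (ft_mean y0_in)).
Qed.

Let bias k w := z k w - f (y k w) - value_noise k w.

(** The transport of [z] by [V k.+1] misses the increment of [f] by the new Jacobian error applied
    to the displacement, plus a Taylor remainder. The expansion is based at the new point because
    the update uses the new tracker. *)
Lemma value_biasS k w : fnorm (bias k.+1 w) <= (1 - step) * fnorm (bias k w)
  + step * (DX * fnorm (jacobian_error k.+1 w) + L * DX ^+ 2 * step).
Proof.
have [s0 [s1 s2]] := sC.
set h := y k.+1 w - y k w; have hle : fnorm h <= step * DX by exact: run_increment_le.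
pose rem := f (y k w) - f (y k.+1 w) + J (y k.+1 w) *m h.
have -> : bias k.+1 w = (1 - step) *: (bias k w + (jacobian_error k.+1 w *m h + rem)).
  case: (run) => [_ rec _ _]; have [_ zE] := rec k w.
  rewrite /bias /= zE /rem /jacobian_error -/h mulmxBl.
  move: (V k.+1 w *m h) (J (y k.+1 w) *m h) => a b.
  by apply/matrixP => i j; rewrite !mxE; ring.
rewrite fnormZ ger0_norm//.
have h1 : fnorm (jacobian_error k.+1 w *m h) <= fnorm (jacobian_error k.+1 w) * (step * DX).
  by rewrite (le_trans (ler_fnorm_mul _ _))// ler_wpM2l ?fnorm_ge0.
have h2 : fnorm rem <= L * (step * DX) ^+ 2.
  have := f_taylor (run_iterate_in k.+1 w) (run_iterate_in k w).
  have -> : y k w - y k.+1 w = - h by rewrite opprB.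
  rewrite mulmxN opprK fnormN => /le_trans; apply.
  by rewrite ler_wpM2l// ler_pXn2r ?nnegrE ?fnorm_ge0// mulr_ge0 ?(ltW DX_gt0).
have h3 := le_trans (ler_fnormD (bias k w) _)
  (lerD (lexx _) (ler_fnormD (jacobian_error k.+1 w *m h) rem)).
have h4 := lerD h1 h2.
have h5 : fnorm (bias k w + (jacobian_error k.+1 w *m h + rem)) <=
  fnorm (bias k w) + step * (DX * fnorm (jacobian_error k.+1 w) + L * DX ^+ 2 * step).
  by rewrite (le_trans h3)// lerD2l (le_trans h4)// le_eqVlt; apply/orP; left; apply/eqP; ring.
rewrite (le_trans (ler_wpM2l s2 h5))// mulrDr lerD2l ler_piMl//.
  by rewrite mulr_ge0// addr_ge0// !mulr_ge0 ?fnorm_ge0 ?exprn_ge0 ?(ltW DX_gt0).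
by rewrite (le_trans (ler_norm _) s1).
Qed.

(** The forcing term in [value_biasS] has the same factor [step] as the contraction, so summation
    loses no power of [step]; the initial bias is zero. *)
Lemma sum_value_bias K w : \sum_(k < K) fnorm (bias k w) <=
  DX * \sum_(k < K) fnorm (jacobian_error k w) + K%:R * (L * DX ^+ 2 * step).
Proof.
have [s0 [s1 s2]] := sC; have /andP[step0 _] := step01.
have c0 : 0 <= L * DX ^+ 2 * step by rewrite !mulr_ge0 ?exprn_ge0 ?(ltW DX_gt0).
have e0 j : 0 <= fnorm (jacobian_error j w) by exact: fnorm_ge0.
have b00 : bias 0 w = 0.
  case: (run) => [init _ _ _]; have [yE zE _] := init w.
  by rewrite /bias/= yE zE subrr.
(* Carrying the last bias makes the induction close. The right side has one more Jacobian error
   because bias k+1 is driven by Jacobian error k+1. *)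
have main j : step * \sum_(k < j) fnorm (bias k w) + fnorm (bias j w) <=
    step * (DX * \sum_(k < j.+1) fnorm (jacobian_error k w) + j%:R * (L * DX ^+ 2 * step)).
  elim: j => [|j ih].
    rewrite big_ord0 mulr0 add0r b00 fnorm0 mul0r addr0 big_ord1 !mulr_ge0//.
    exact: ltW.
  have hb := value_biasS j w; rewrite big_ord_recr/= big_ord_recr/= -natr1.
  move: ih; rewrite big_ord_recr /=; lra.
case: K => [|K]; first by rewrite !big_ord0 mulr0 mul0r addr0.
rewrite -(ler_pM2l step0) big_ord_recr/= mulrDr.
have h := main K; have sb : step * fnorm (bias K w) <= fnorm (bias K w).
  by rewrite ler_piMl ?fnorm_ge0//; case/andP: step01.
rewrite (le_trans (lerD (lexx _) sb))// (le_trans h)// ler_wpM2l//.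
by rewrite lerD2l ler_wpM2r// ler_nat.
Qed.

(** * Summation of the Frank-Wolfe gaps *)

Variables (LF phi_inf : R).
Hypotheses (LF_ge0 : 0 <= LF)
  (F_lipschitz : forall (x : 'cV[R]_d) (u1 u2 : 'cV[R]_n), X x ->
     `|F u1 x - F u2 x| <= LF * fnorm (u1 - u2))
  (F_convex : convex_function ([set: 'cV[R]_n] `*` X)
     (fun q : 'cV[R]_n * 'cV[R]_d => F q.1 q.2))
  (gap_min : forall y, X y ->
     exists x, is_argmin X (fun x => F (f y + J y *m (x - y)) x) x)
  (phi_lb : forall x, X x -> phi_inf <= F (f x) x).

Let gap k w := fw_gap X F f J (y k w).

(** Jacobian errors count twice, directly and through the bias, which turns 2 into 4; the 3 is 1
    from the descent inequality plus 2 from the bias. *)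
Lemma sum_gap_le K w : \sum_(k < K) gap k w <=
  (F (f y0) y0 - phi_inf) / step + 3 * LF * L * DX ^+ 2 * step * K%:R
  + 2 * LF * \sum_(k < K) fnorm (value_noise k w)
  + 4 * LF * DX * \sum_(k < K) fnorm (jacobian_error k w).
Proof.
have /andP[step0 step1] := step01.
pose phi k := F (f (y k w)) (y k w).
pose err k := fnorm (value_noise k w) + fnorm (bias k w) + DX * fnorm (jacobian_error k w).
have desc k : step * gap k w <= phi k - phi k.+1 +
    step * (2 * LF * err k) + LF * L * DX ^+ 2 * step ^+ 2.
  case: (run) => [_ _ /(_ k w)[xmin yE] _].
  have step01' : 0 <= step <= 1 by rewrite ltW.
  have := fw_gap_descent X_convex LF_ge0 L_ge0 (ltW DX_gt0) X_diam F_lipschitz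
    F_convex gap_min f_taylor step01' (run_iterate_in k w) xmin yE.
  move=> /le_trans; apply; rewrite lerD2r lerD2l ler_wpM2l ?(ltW step0)//.
  rewrite ler_wpM2l ?mulr_ge0// lerD2r.
  have -> : z k w - f (y k w) = value_noise k w + bias k w by rewrite /bias [RHS]addrC subrK.
  exact: ler_fnormD.
have tele : step * \sum_(k < K) gap k w <= phi 0%N - phi K
    + step * (2 * LF * \sum_(k < K) err k) + K%:R * (LF * L * DX ^+ 2 * step ^+ 2).
  elim: K => [|K ih].
    by rewrite !big_ord0 !mulr0 mul0r !addr0 subrr.
  rewrite !big_ord_recr/= -natr1; have := desc K; move: ih; lra.
have phiK : phi_inf <= phi K by exact: phi_lb (run_iterate_in K w).
have phi0 : phi 0%N = F (f y0) y0.
  by case: (run) => [init _ _ _]; rewrite /phi; have [-> _ _] := init w.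
have errE : \sum_(k < K) err k <= \sum_(k < K) fnorm (value_noise k w)
    + 2 * DX * \sum_(k < K) fnorm (jacobian_error k w) + K%:R * (L * DX ^+ 2 * step).
  rewrite /err !big_split/= -mulr_sumr; have := sum_value_bias K w; lra.
rewrite -(ler_pM2l step0) (le_trans tele)//.
have h := ler_wpM2l (ltW step0) (ler_wpM2l (mulr_ge0 (ler0n R 2) LF_ge0) errE).
have -> : step * ((F (f y0) y0 - phi_inf) / step + 3 * LF * L * DX ^+ 2 * step * K%:R
  + 2 * LF * \sum_(k < K) fnorm (value_noise k w)
  + 4 * LF * DX * \sum_(k < K) fnorm (jacobian_error k w)) =
  (F (f y0) y0 - phi_inf) + step * (3 * LF * L * DX ^+ 2 * step * K%:R
  + 2 * LF * \sum_(k < K) fnorm (value_noise k w)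
  + 4 * LF * DX * \sum_(k < K) fnorm (jacobian_error k w)).
  by field; rewrite gt_eqF.
rewrite phi0; move: h; lra.
Qed.

Lemma ge0_integral_scaled_sum (c : R) K (u : nat -> Omega -> R) : 0 <= c ->
  (forall k, measurable_fun setT (u k)) -> (forall k w, 0 <= u k w) ->
  (\int[P]_w (c * \sum_(k < K) u k w)%:E = c%:E * \sum_(k < K) \int[P]_w (u k w)%:E)%E.
Proof.
move=> c0 mu u0; under eq_integral do rewrite EFinM -sumEFin.
have mE k : measurable_fun setT (fun w => (u k w)%:E) by apply/measurable_EFinP.
rewrite ge0_integralZl//.
- by rewrite ge0_integral_sum// => k w _; rewrite lee_fin.
- by apply: emeasurable_sum.
- by move=> w _; apply: sume_ge0 => k _; rewrite lee_fin.
Qed.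

Let B1' : R := 1 + sigma_g `^ r + B1.
Let B2' : R := 1 + sigma_f `^ r + 6 * sigma_f `^ r.

(** Superadditivity of the lower integral takes the sum inside, and the pathwise bound replaces the
    gaps by measurable quantities, for which the integral is linear. *)
Lemma expected_gap_sum K :
  (\sum_(1 <= k < K.+1) 'E_P[fun w => fw_gap X F f J (y k w)] <=
   ((F (f y0) y0 - phi_inf + 3 * LF * L * DX ^+ 2 + 4 * LF * B2' + 8 * LF * DX * B1')
    * (step^-1 + K.+1%:R * (step `^ ((r - 1) / r) + step)))%:E)%E.
Proof.
have /andP[step0 step1] := step01; have /andP[r1 r2] := r12.
have gap0 k w : 0 <= gap k w by apply: fw_gap_ge0 => //; exact: run_iterate_in.
pose c0 := (F (f y0) y0 - phi_inf) / step + 3 * LF * L * DX ^+ 2 * step * K.+1%:R.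
pose sq w := 2 * LF * \sum_(k < K.+1) fnorm (value_noise k w).
pose se w := 4 * LF * DX * \sum_(k < K.+1) fnorm (jacobian_error k w).
have D0 : 0 <= F (f y0) y0 - phi_inf by rewrite subr_ge0 phi_lb.
have c00 : 0 <= c0.
  by rewrite addr_ge0 ?divr_ge0 ?(ltW step0)// !mulr_ge0 ?exprn_ge0 ?(ltW step0) ?(ltW DX_gt0).
have k1 : 0 <= 2 * LF by rewrite mulr_ge0.
have k2 : 0 <= 4 * LF * DX by rewrite !mulr_ge0 ?(ltW DX_gt0).
have mq k : measurable_fun (setT : set Omega) (fun w => fnorm (value_noise k w)).
  by apply: measurable_fnorm; exact: (after_mx_measurable (@value_noise_measurable k)).
have me k : measurable_fun (setT : set Omega) (fun w => fnorm (jacobian_error k w)).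
  by apply: measurable_fnorm; exact: (after_mx_measurable (@jacobian_error_measurable k)).
have msq : measurable_fun setT sq by apply: measurable_funM => //; apply: measurable_sum.
have mse : measurable_fun setT se by apply: measurable_funM => //; apply: measurable_sum.
have sq0 w : 0 <= sq w by rewrite mulr_ge0// sumr_ge0// => k _; exact: fnorm_ge0.
have se0 w : 0 <= se w by rewrite mulr_ge0// sumr_ge0// => k _; exact: fnorm_ge0.
have -> : (\sum_(1 <= k < K.+1) 'E_P[fun w => fw_gap X F f J (y k w)] =
    \sum_(1 <= k < K.+1) \int[P]_w (gap k w)%:E)%E.
  by apply: eq_bigr => k _; rewrite unlock.
have h1 := @ge0_integral_sum_nomeas _ _ _ P _ (index_iota 1 K.+1) (fun k w => (gap k w)%:E)
  (fun k w _ => gap0 k w).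
rewrite (le_trans h1)//.
have h2 : (\int[P]_w (\sum_(k <- index_iota 1 K.+1) (gap k w)%:E) <=
    \int[P]_w (c0%:E + ((sq w)%:E + (se w)%:E)))%E.
  apply: ge0_le_integral_nomeas => w.
    by apply: sume_ge0 => k _; rewrite lee_fin gap0.
  rewrite sumEFin -!EFinD lee_fin addrA (le_trans _ (sum_gap_le K.+1 w))//.
  (* The nonnegative gap at k = 0 is added back, so the sums run over K+1 indices. *)
  by rewrite -(big_mkord xpredT (fun k => gap k w)) big_nat_recl//= big_add1/= lerDr gap0.
rewrite (le_trans h2)// ge0_integralD//; last first.
- by apply: emeasurable_funD; apply/measurable_EFinP.
- by move=> w _; rewrite adde_ge0// lee_fin.
rewrite integral_cst//= probability_setT mule1 ge0_integralD//; last 4 first.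
- by move=> w _; rewrite lee_fin.
- by apply/measurable_EFinP.
- by move=> w _; rewrite lee_fin.
- by apply/measurable_EFinP.
have -> := ge0_integral_scaled_sum K.+1 k1 mq (fun k w => fnorm_ge0 (value_noise k w)).
have -> := ge0_integral_scaled_sum K.+1 k2 me (fun k w => fnorm_ge0 (jacobian_error k w)).
have B10 : 0 <= B1 by rewrite mulr_ge0// !addr_ge0 ?mulr_ge0 ?powR_ge0.
have B20 : 0 <= 6 * sigma_f `^ r by rewrite mulr_ge0 ?powR_ge0.
have hq := sum_mean_fnorm_recursion r12 step01 (powR_ge0 _ _) B20
  (fun k => after_mx_measurable (@value_noise_measurable k))
  value_noise0_moment value_noise_moment_step K.+1.
have he := sum_mean_fnorm_recursion r12 step01 (powR_ge0 _ _) B10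
  (fun k => after_mx_measurable (@jacobian_error_measurable k))
  jacobian_error0_moment jacobian_moment_step K.+1.
have k1' : (0 <= (2 * LF)%:E)%E by rewrite lee_fin.
have k2' : (0 <= (4 * LF * DX)%:E)%E by rewrite lee_fin.
rewrite (le_trans (leeD2l _ (leeD (lee_wpmul2l k1' hq) (lee_wpmul2l k2' he))))//.
rewrite -!EFinM -!EFinD lee_fin -/B1' -/B2' /c0.
have i0 : 0 <= step^-1 by rewrite invr_ge0 ltW.
have B1'0 : 0 <= B1' by rewrite /B1' !addr_ge0 ?powR_ge0.
have B2'0 : 0 <= B2' by rewrite /B2' !addr_ge0 ?powR_ge0.
move: (step `^ _) (powR_ge0 step ((r - 1) / r)) => b b0.
have K0 : 0 <= K.+1%:R :> R by [].
move: (K.+1%:R) K0 => N N0.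
have A1 : 0 <= 3 * LF * L * DX ^+ 2 by rewrite !mulr_ge0 ?exprn_ge0 ?(ltW DX_gt0).
have A2 : 0 <= LF * B2' by rewrite mulr_ge0.
have A3 : 0 <= LF * DX * B1' by rewrite !mulr_ge0 ?(ltW DX_gt0).
have -> : 4 * LF * B2' = 4 * (LF * B2') by rewrite mulrA.
have -> : 8 * LF * DX * B1' = 8 * (LF * DX * B1') by rewrite !mulrA.
have -> : 4 * LF * DX * (B1' * (2 / step + N * b)) =
    4 * (LF * DX * B1') * (2 / step + N * b) by rewrite !mulrA.
have -> : 2 * LF * (B2' * (2 / step + N * b)) = 2 * (LF * B2') * (2 / step + N * b).
  by rewrite !mulrA.
have -> : 3 * LF * L * DX ^+ 2 * step * N = (3 * LF * L * DX ^+ 2) * (N * step).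
  by rewrite !mulrA mulrAC.
move: (F _ _ - _) D0 (3 * LF * L * _) A1 (LF * B2') A2 (LF * DX * B1') A3.
move=> a0 a0_ge0 a1 a1_ge0 a2 a2_ge0 a3 a3_ge0.
have Nb : 0 <= N * b by rewrite mulr_ge0.
have Ns : 0 <= N * step by rewrite mulr_ge0 ?(ltW step0).
rewrite [N * (b + step)]mulrDr; move: (N * b) (N * step) (step^-1) Nb Ns i0.
move=> u v i u0 v0 i0.
(* The term 2/step of the moment sums doubles the coefficients 2 and 4 into 4 and 8; the cross terms
   present only on the right are nonnegative. *)
have := mulr_ge0 a0_ge0 u0; have := mulr_ge0 a0_ge0 v0.
have := mulr_ge0 a1_ge0 u0; have := mulr_ge0 a1_ge0 i0.
have := mulr_ge0 a2_ge0 u0; have := mulr_ge0 a2_ge0 v0.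
have := mulr_ge0 a3_ge0 u0; have := mulr_ge0 a3_ge0 v0.
lra.
Qed.

End Run.

(** * The constant schedule *)

(** The origin of the exponent: for this [step] both 1/(K step) and step^((r-1)/r) equal the
    announced rate, and [step] itself is no larger. *)
Lemma step_schedule (R : realType) (r : R) (K : nat) : 1 < r <= 2 -> (0 < K)%N ->
  let step := K%:R `^ (- (r / (2 * r - 1))) in
  let rate := K%:R `^ (- ((r - 1) / (2 * r - 1))) in
  [/\ 0 < step <= 1, step <= rate, step^-1 = K%:R * rate
    & step `^ ((r - 1) / r) = rate].
Proof.
move=> /andP[r1 r2] K0 step rate; have q0 : 0 < 2 * r - 1 by lra.
have K1 : 1 <= K%:R :> R by rewrite ler1n.
have Kgt0 : 0 < K%:R :> R by rewrite ltr0n.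
have r0 : r != 0 by rewrite gt_eqF//; lra.
split.
- rewrite powR_gt0//= -(powRr0 K%:R) ler_powR// oppr_le0 divr_ge0//; lra.
- by rewrite ler_powR// lerN2 ler_pM2r ?invr_gt0//; lra.
- transitivity (K%:R `^ 1 * rate); last by rewrite powRr1 ?ltW.
  rewrite -powRN opprK /rate -powRD.
    by congr (_ `^ _); field; rewrite gt_eqF.
  by rewrite (gt_eqF Kgt0) implybT.
- by rewrite -powRrM; congr (_ `^ _); field; rewrite r0 gt_eqF.
Qed.

Lemma bigmine_le_average (R : realType) (K : nat) (a : nat -> \bar R) (c : R) : (0 < K)%N ->
  (\sum_(1 <= k < K.+1) a k <= (K%:R * c)%:E)%E ->
  (\big[mine/+oo]_(1 <= k < K.+1) a k <= c%:E)%E.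
Proof.
move=> K0; set M := (\big[mine/_]_(_ <= _ < _) _)%E => ac.
have Kgt0 : 0 < K%:R :> R by rewrite ltr0n.
have KM : (K%:R%:E * M <= (K%:R * c)%:E)%E.
  apply: le_trans ac; rewrite mule_natl.
  have -> : (M *+ K = \sum_(1 <= k < K.+1) M)%E by rewrite sumr_const_nat subn1.
  rewrite big_seq [leRHS]big_seq; apply: lee_sum => k kK.
  exact: ge_bigmin_seq.
by move: KM; rewrite EFinM lee_pmul2l ?lte_fin.
Qed.

Theorem theorem4 (R : realType) (d n : nat)
  (* the problem *)
  (X : set 'cV[R]_d) (F : 'cV[R]_n -> 'cV[R]_d -> R)
  (f : 'cV[R]_d -> 'cV[R]_n) (J : 'cV[R]_d -> 'M[R]_(n, d))
  (H : 'cV[R]_d -> {linear 'cV[R]_d -> 'M[R]_(n, d)})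
  (* the stochastic oracle *)
  (dXi : measure_display) (Xi : measurableType dXi) (D : probability Xi R)
  (ft : 'cV[R]_d -> Xi -> 'cV[R]_n) (Jt : 'cV[R]_d -> Xi -> 'M[R]_(n, d))
  (Ht : 'cV[R]_d -> Xi -> {linear 'cV[R]_d -> 'M[R]_(n, d)})
  (LF L r sigma_f sigma_g sigma_H : R) (y0 : 'cV[R]_d)
  (* (1) *)
  (X_convex : convex_set X) (X_compact : compact X)
  (* (2) *)
  (F_lipschitz : forall (x : 'cV[R]_d) (u1 u2 : 'cV[R]_n), X x ->
     `|F u1 x - F u2 x| <= LF * fnorm (u1 - u2))
  (F_monotone : forall (x : 'cV[R]_d) (u1 u2 : 'cV[R]_n), X x ->
     (forall i, u1 i 0 <= u2 i 0) -> F u1 x <= F u2 x)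
  (F_subhomogeneous : forall (x : 'cV[R]_d) (u : 'cV[R]_n) (c : R), X x -> 1 <= c ->
     F (c *: u) x <= c * F u x)
  (* standing assumption on the problem class: (u, x) |-> F(u, x) is convex *)
  (F_convex : convex_function ([set: 'cV[R]_n] `*` X)
     (fun q : 'cV[R]_n * 'cV[R]_d => F q.1 q.2))
  (* minima over X are attained *)
  (phi_min : exists x, is_argmin X (fun x => F (f x) x) x)
  (gap_min : forall y, X y ->
     exists x, is_argmin X (fun x => F (f y + J y *m (x - y)) x) x)
  (* (3) *)
  (f_C2 : C2_on X f J H)
  (J_lipschitz : forall x y, X x -> X y ->
     opnorm (fun h => (J x - J y) *m h) <= L * fnorm (x - y))
  (H_bounded : forall x, X x -> opnorm (fun h => H x h) <= L)
  (* (4) *)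
  (r_range : 1 < r <= 2)
  (sigma_f_ge0 : 0 <= sigma_f) (sigma_g_ge0 : 0 <= sigma_g)
  (ft_meas : jointly_measurable X ft) (Jt_meas : jointly_measurable X Jt)
  (ft_mean : forall x, X x -> is_mean D (ft x) (f x))
  (Jt_mean : forall x, X x -> is_mean D (Jt x) (J x))
  (ft_moment : forall x, X x ->
     ('E_D[fun s => (fnorm (ft x s - f x) `^ r)%R] <= (sigma_f `^ r)%:E)%E)
  (Jt_moment : forall x, X x ->
     ('E_D[fun s => (fnorm (Jt x s - J x) `^ r)%R] <= (sigma_g `^ r)%:E)%E)
  (* (5) *)
  (sigma_H_ge0 : 0 <= sigma_H)
  (ft_twice_diff : {ae D, forall s,
     twice_differentiable_on X (ft^~ s) (Jt^~ s) (Ht^~ s)})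
  (Ht_meas : forall h, jointly_measurable X (fun x s => Ht x s h))
  (Ht_mean : forall x h, X x -> is_mean D (fun s => Ht x s h) (H x h))
  (Ht_moment : forall x, X x ->
     ('E_D[fun s => (opnorm (fun h => Ht x s h - H x h) `^ r)%R]
        <= (sigma_H `^ r)%:E)%E)
  (y0_in : X y0) :
  exists C : R, \forall K \near \oo,
    forall (dO : measure_display) (Omega : measurableType dO)
      (P : probability Omega R)
      (xi zeta : nat -> {RV P >-> Xi}) (alpha : nat -> {RV P >-> R})
      (x y : nat -> Omega -> 'cV[R]_d) (z : nat -> Omega -> 'cV[R]_n)
      (V : nat -> Omega -> 'M[R]_(n, d)),
    let step := K%:R `^ (- (r / (2 * r - 1))) in
    sampling D xi zeta alpha ->
    hessian_sfw_run X F ft Jt Ht y0 step step step xi zeta alpha x y z V ->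
    (`| \big[mine/+oo]_(1 <= k < K.+1)
          'E_P[fun w => fw_gap X F f J (y k w)] |
       <= (C * K%:R `^ (- ((r - 1) / (2 * r - 1))))%:E)%E.
Proof.
have /andP[r1 r2] := r_range.
have [[f_der J_der] H_cont] := f_C2.
have L_ge0 : 0 <= L by apply: le_trans (H_bounded y0 y0_in); exact: opnorm_ge0.
have [DX0 DX0_ge0 X_diam0] := compact_fnorm_diameter X_compact.
(* The added 1 makes the diameter bound strictly positive. *)
pose DX := DX0 + 1.
have DX_gt0 : 0 < DX by rewrite ltr_wpDl.
have X_diam x y : X x -> X y -> fnorm (x - y) <= DX.
  by move=> Xx Xy; rewrite (le_trans (X_diam0 _ _ Xx Xy))// lerDl.
have f_taylor := taylor_remainder X_convex L_ge0 f_der J_lipschitz.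
(* The absolute value is again a Lipschitz constant, and it is nonnegative. *)
have F_lip x u1 u2 : X x -> `|F u1 x - F u2 x| <= `|LF| * fnorm (u1 - u2).
  move=> Xx; rewrite (le_trans (F_lipschitz _ _ _ Xx))// ler_wpM2r ?fnorm_ge0//.
  exact: ler_norm.
have [xm [Xxm xm_min]] := phi_min.
pose C := F (f y0) y0 - F (f xm) xm + 3 * `|LF| * L * DX ^+ 2
  + 4 * `|LF| * (1 + sigma_f `^ r + 6 * sigma_f `^ r)
  + 8 * `|LF| * DX * (1 + sigma_g `^ r
      + 6 * ((2 * L * DX) `^ r + DX `^ r * sigma_H `^ r + sigma_g `^ r)).
(* 1/step = K * rate, and (K+1)(rate + step) <= 2K * 2 rate: together five times K * rate. The
   constant is fixed before [K], the probability space and the run. *)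
exists (5 * `|C|); near=> K.
have K0 : (0 < K)%N by near: K; exact: nbhs_infty_gt.
move=> dO Omega P xi zeta alpha x y z V samp run.
have /= [step01 step_rate stepV step_b] := step_schedule r_range K0.
set step := K%:R `^ (- (r / _)) in samp run step01 step_rate stepV step_b *.
have sum_gap := expected_gap_sum X_convex X_compact X_diam DX_gt0 L_ge0 f_taylor
  J_der H_bounded H_cont r_range ft_meas Jt_meas ft_mean Jt_mean ft_moment Jt_moment
  Ht_meas Ht_mean Ht_moment y0_in samp run step01 (normr_ge0 LF) F_lip F_convex
  gap_min xm_min K.
rewrite -/C in sum_gap.
(* The minimum is nonnegative: its default value is +oo and all expected gaps are nonnegative. *)
rewrite gee0_abs; last first.
  apply: (big_ind (fun v : \bar R => (0 <= v)%E)) => // [a b a0 b0|k _]; first by rewrite le_min a0.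
  apply: expectation_ge0 => w; apply: (fw_gap_ge0 gap_min).
  exact: (run_iterate_in X_convex y0_in run step01).
apply: bigmine_le_average => //; rewrite (le_trans sum_gap)// lee_fin.
have C0 : `|C| * (step^-1 + K.+1%:R * (step `^ ((r - 1) / r) + step)) <=
    K%:R * (5 * `|C| * K%:R `^ (- ((r - 1) / (2 * r - 1)))).
  rewrite step_b stepV; move: (K%:R `^ (- ((r - 1) / _))) step_rate => e step_e.
  have e0 : 0 <= e by rewrite (le_trans _ step_e)// ltW; case/andP: step01.
  have K1 : K.+1%:R <= 2 * K%:R :> R by rewrite -natrM ler_nat mul2n -addnn -addn1 leq_add2l.
  have -> : K%:R * (5 * `|C| * e) = `|C| * (K%:R * e + 2 * K%:R * (2 * e)) by ring.
  rewrite ler_wpM2l// lerD2l ler_pM//.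
    by rewrite addr_ge0// ltW; case/andP: step01.
  by rewrite mulr_natl mulr2n lerD2l.
apply: le_trans C0; rewrite ler_wpM2r ?ler_norm//.
rewrite addr_ge0 ?mulr_ge0 ?addr_ge0 ?powR_ge0 ?invr_ge0//; by case/andP: step01 => /ltW.
Unshelve. all: by end_near.
Qed.
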